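(* (i) Any $m\in\mathbb{N}$ can be written as $x^2+y^2+z^2+w^2$ with $x,y,z\in\mathbb{Q}_{\ge 0}$ and $w\in\mathbb{N}$ such that $x+y+z+2w\in\mathbb{Q}^2$. (ii) Any $m\in\mathbb{N}$ can be written as $x^2+y^2+z^2+w^2$ with $x,y,z,w\in\mathbb{N}/5$ such that $x+y+2z+3w\in\mathbb{Z}^2$. (iii) Any $m\in\mathbb{N}$ can be written as $x^2+y^2+z^2+w^2$ with $y\in\mathbb{N}$ and $x,z,w\in\mathbb{Q}_{\ge 0}$ such that $x+2y+3z+3w\in\mathbb{Z}^2$.
   Context: $\mathbb{N}=\{0,1,2,\ldots\}$; $\mathbb{Q}_{\ge 0}$ is the set of nonnegative rational numbers; $\mathbb{N}/5=\{k/5: k\in\mathbb{N}\}$; $\mathbb{Z}^2=\{t^2: t\in\mathbb{Z}\}$ and $\mathbb{Q}^2=\{t^2: t\in\mathbb{Q}\}$ denote the sets of integer squares and rational squares (not Cartesian powers). *)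

(* Defs.v *)
From mathcomp Require Import all_boot all_order all_algebra.

Set Implicit Arguments.
Unset Strict Implicit.
Unset Printing Implicit Defensive.

Import Order.TTheory GRing.Theory Num.Theory.

Local Open Scope ring_scope.

Definition nat_fifth (x : rat) : Prop := exists k : nat, x = k%:R / 5.

Definition int_square (x : rat) : Prop := exists t : int, x = t%:~R ^+ 2.

Definition rat_square (x : rat) : Prop := exists t : rat, x = t ^+ 2.

(* Main.v *)
From Stdlib Require Import NArith.
Require Import Defs.
From mathcomp Require Import all_boot all_order all_algebra.
From mathcomp Require Import all_fingroup all_solvable all_field.
From mathcomp Require Import realalg zify ring lra.

Set Implicit Arguments.
Unset Strict Implicit.
Unset Printing Implicit Defensive.

Import Order.TTheory GRing.Theory Num.Theory.

Local Open Scope ring_scope.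

(** The three parts have a common shape.  Let v be the coefficient vector of
    the linear form: (1, 2, k, k) with k = 1 in (i) and k = 3 in (iii), and
    (1, 1, 2, 3) in (ii).  Let p be its squared length, 7, 23 and 15
    respectively.  By Euler's four-square identity, v and three vectors of the
    same length, orthogonal to v and to each other, give coordinates
    (T, a, b, c) in which T is the linear form and
    p (x^2 + y^2 + z^2 + w^2) = T^2 + a^2 + b^2 + c^2.  So one looks for t such
    that p m - t^4 is a sum of three squares a^2 + b^2 + c^2, puts T = t^2, and
    chooses the order and the signs of a, b, c so that (x, y, z, w) lies in the
    prescribed set.

    Choice of t.  All three p are 7 modulo 8.  Hence, unless 16 divides m, the
    parity of t can be chosen so that p m - t^4 is not of the form
    4^a (8 b + 7) ([ternary_class4_sub]), and it is a sum of three squares.  If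
    16 divides m, multiply a solution for m / 16 by 4.  The positivity
    conditions below ask that t^4 lie between a constant multiple of m and p m.
    This interval contains fourth powers of both parities once m is large; the
    remaining m are settled by computation.

    Domain in (i) and (iii).  Only y has to be an integer, a congruence modulo
    p that some arrangement of a, b, c satisfies ([signed_representative]).
    It is nonnegative by Cauchy-Schwarz when (2 k^2 + 1) m <= t^4.  The other
    unknowns form a rational point on the circle cut from a sphere by the plane
    x + k z + k w = t^2 - 2 y.  Rational points are dense on this circle, and
    it passes through the interior of the octant x, z, w >= 0 when 5 m < t^4
    ([nonneg_point_on_circle]).

    Domain in (ii).  One has 15 (x, y, z, w) = T v + a v1 + b v2 + c v3, and
    the right side is divisible by 3 if v1, v2, v3 are chosen according to the
    residues of a, b, c modulo 3.  All entries are nonnegative when they are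
    chosen also according to the order of a, b, c, and
    a^2 + b^2 + c^2 <= T^2, that is 15 m <= 2 t^4 ([fifths_of_sum3sq]).

    Three squares.  As in Dirichlet's proof, n is represented by a positive
    ternary form of determinant 1, which reduces to x^2 + y^2 + z^2
    ([gram3_unimodular], [sum3sq_of_binary]).  The form exists as soon as there
    is d prime to n such that - n is a square modulo d and - d is a square
    modulo every prime factor of n.  Dirichlet takes for d a prime in an
    arithmetic progression, or twice such a prime.  Here a square-free
    number replaces the prime, which is much easier to achieve
    ([prescribed_characters]).  Let the lam i be the quadratic characters with
    prescribed values eps i at d, let chi be their product and R(q) the sum of
    chi over the divisors of q, so that R >= 0 and R >= 1 at squares.  Expand
    the product in
      \sum_(q <= Y^2) R(q) q^(-1/2) \prod_i (1 + eps i lam i(q)).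
    The two extreme terms are at least a sum of 1 / k, which is unbounded, and
    each other term is a hyperbola sum of two nontrivial characters, which is
    bounded.  Some q thus has R(q) <> 0 and lam i(q) = eps i for all i, and its
    square-free part d has these properties and chi = 1 at all its primes.
    Quadratic reciprocity turns the latter into the condition on - n. *)

(** * Positive ternary forms of determinant one *)

Definition dot (u v : int * int * int) : int :=
  u.1.1 * v.1.1 + u.1.2 * v.1.2 + u.2 * v.2.

(** The symmetric matrix with diagonal a, b, c and entries r (1, 2), s (1, 3),
    t (2, 3). Being a Gram matrix of integer vectors means that the quadratic
    form is obtained from x^2 + y^2 + z^2 by an integral substitution. *)
Definition gram3 (a b c r s t : int) : Prop :=
  exists u v w : int * int * int,
    [/\ [/\ dot u u = a, dot v v = b & dot w w = c],
        dot u v = r, dot u w = s & dot v w = t].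

Definition add_multiple (k : int) (u v : int * int * int) : int * int * int :=
  (v.1.1 + k * u.1.1, v.1.2 + k * u.1.2, v.2 + k * u.2).

Lemma gram3_swap_uv a b c r s t : gram3 b a c r t s -> gram3 a b c r s t.
Proof.
move=> [u [v [w [[ha hb hc] hr hs ht]]]]; exists v, u, w.
by split => //; rewrite -hr /dot; ring.
Qed.

Lemma gram3_swap_vw a b c r s t : gram3 a c b s r t -> gram3 a b c r s t.
Proof.
move=> [u [v [w [[ha hb hc] hr hs ht]]]]; exists u, w, v.
by split => //; rewrite -ht /dot; ring.
Qed.

Lemma gram3_add_uv k a b c r s t :
  gram3 a (b + 2 * k * r + k ^+ 2 * a) c (r + k * a) s (t + k * s) ->
  gram3 a b c r s t.
Proof.
move=> [u [v [w [[ha hb hc] hr hs ht]]]]; exists u, (add_multiple (- k) u v), w.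
have e1 z : dot (add_multiple (- k) u v) z = dot v z - k * dot u z.
  by rewrite /dot /add_multiple /=; ring.
have e2 z : dot z (add_multiple (- k) u v) = dot z v - k * dot z u.
  by rewrite /dot /add_multiple /=; ring.
have hvu : dot v u = r + k * a by rewrite -hr /dot; ring.
by split; rewrite ?e1 ?e2 ?ha ?hb ?hc ?hr ?hs ?ht ?hvu //; try split => //; ring.
Qed.

Lemma gram3_add_uw k a b c r s t :
  gram3 a b (c + 2 * k * s + k ^+ 2 * a) r (s + k * a) (t + k * r) ->
  gram3 a b c r s t.
Proof.
move=> h; apply: gram3_swap_vw; apply: (gram3_add_uv (k := k)).
exact: gram3_swap_vw.
Qed.

Lemma gram3_add_vw k a b c r s t :
  gram3 a b (c + 2 * k * t + k ^+ 2 * b) r (s + k * r) (t + k * b) ->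
  gram3 a b c r s t.
Proof.
move=> h; apply: gram3_swap_uv; apply: (gram3_add_uw (k := k)).
exact: gram3_swap_uv.
Qed.

Lemma balanced_rem (a r : int) : 0 < a ->
  exists k : int, (- a <= 2 * (r + k * a)) /\ (2 * (r + k * a) <= a).
Proof.
move=> a0; exists (- ((2 * r + a) %/ (2 * a))%Z).
have h := divz_eq (2 * r + a) (2 * a).
have h1 : (0 <= ((2 * r + a) %% (2 * a))%Z) by apply: modz_ge0; lia.
have h2 : ((2 * r + a) %% (2 * a))%Z < 2 * a by apply: ltz_pmod; lia.
by move: h h1 h2; set q := divz _ _; set z := modz _ _; nia.
Qed.

Lemma four_sqr_le (B T : int) : - B <= 2 * T -> 2 * T <= B -> 4 * T ^+ 2 <= B ^+ 2.
Proof.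
move=> h1 h2; rewrite -subr_ge0.
have -> : B ^+ 2 - 4 * T ^+ 2 = (B - 2 * T) * (B + 2 * T) by ring.
by apply: mulr_ge0; lia.
Qed.

Definition det3 (a b c r s t : int) :=
  a * b * c + 2 * r * s * t - a * t ^+ 2 - b * s ^+ 2 - c * r ^+ 2.

(** The binary form with coefficients B = a b - r^2, T = a t - r s and C = a c
    - s^2 has B C - T^2 = a when the determinant is 1, and changes of the last
    two basis vectors act on it as on any binary form. Its reduction gives 3
    B^2 <= 4 a. *)
Lemma gram3_minor (a b c r s t : int) :
  0 < a -> 0 < a * b - r ^+ 2 -> det3 a b c r s t = 1 ->
  (forall b' c' r' s' t' : int, 0 < a * b' - r' ^+ 2 ->
      det3 a b' c' r' s' t' = 1 ->
      3 * (a * b' - r' ^+ 2) ^+ 2 <= 4 * a -> gram3 a b' c' r' s' t') ->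
  gram3 a b c r s t.
Proof.
move=> a0 B0 hd hmin; move: B0 hd.
have [n] := ubnP (absz (a * b - r ^+ 2)%R).
elim: n b c r s t => // n IH b c r s t hn B0 hd.
have [k [k1 k2]] := balanced_rem (a * t - r * s) B0.
apply: (gram3_add_vw (k := k)).
set B := a * b - r ^+ 2 in B0 hn k1 k2 *.
set c' := c + _ + _; set s' := s + _; set t' := t + _.
have hd' : det3 a b c' r s' t' = 1 by rewrite -hd /det3 /c' /s' /t'; ring.
set T := a * t' - r * s'.
have ET : T = a * t - r * s + k * B by rewrite /T /B /t' /s'; ring.
rewrite -ET in k1 k2.
have EG : B * (a * c' - s' ^+ 2) = a + T ^+ 2.
  transitivity (a * det3 a b c' r s' t' + T ^+ 2).
    by rewrite /det3 /B /T; ring.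
  by rewrite hd' mulr1.
set C := a * c' - s' ^+ 2 in EG.
have T4 := four_sqr_le k1 k2.
have C0 : 0 < C.
  by rewrite -(pmulr_rgt0 _ B0) EG; have := sqr_ge0 T; lia.
case: (leP B C) => hBC.
  apply: hmin => //; rewrite -/B.
  have : B * B <= B * C by rewrite ler_pM2l.
  by rewrite EG -expr2; lia.
apply: gram3_swap_vw; apply: IH.
- rewrite -/C; lia.
- by [].
- by rewrite -hd' /det3; ring.
Qed.

(** Reduce the binary form (a, r, b) as well, so that 3 a^2 <= 4 B; with 3 B^2
    <= 4 a this forces a = B = 1, and then b = 1. The last vector is cleared
    by subtracting multiples of the first two. *)
Lemma gram3_unimodular (a b c r s t : int) :
  0 < a -> 0 < a * b - r ^+ 2 -> det3 a b c r s t = 1 -> gram3 a b c r s t.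
Proof.
have [n] := ubnP (absz a).
elim: n a b c r s t => // n IH a b c r s t hn a0 B0 hd.
apply: gram3_minor => // {b c r s t B0 hd} b c r s t B0 hd hB.
have [k [k1 k2]] := balanced_rem r a0.
apply: (gram3_add_uv (k := k)).
set b' := b + _ + _; set r' := r + _; set t' := t + _.
have hd' : det3 a b' c r' s t' = 1 by rewrite -hd /det3 /b' /r' /t'; ring.
have EB : a * b' - r' ^+ 2 = a * b - r ^+ 2 by rewrite /b' /r'; ring.
rewrite -EB in B0 hB; rewrite -/r' in k1 k2.
have b0 : 0 < b'.
  by rewrite -(pmulr_rgt0 _ a0); have := sqr_ge0 r'; lia.
case: (ltP b' a) => hba.
  apply: gram3_swap_uv; apply: IH => //.
  - lia.
  - by rewrite mulrC.
  - by rewrite -hd' /det3; ring.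
have r4 := four_sqr_le k1 k2.
have a34 : 3 * a ^+ 2 <= 4 * (a * b' - r' ^+ 2).
  have : a * a <= a * b' by rewrite ler_pM2l.
  by rewrite -expr2; lia.
(* From 3 a^2 <= 4 B and 3 B^2 <= 4 a: 27 a^3 <= 64. *)
have a1 : a = 1.
  have : a < 2.
    rewrite ltNge; apply/negP => a2.
    set M := _ - _ in a34 hB B0.
    have h9 : (3 * a ^+ 2) ^+ 2 <= (4 * M) ^+ 2.
      by rewrite lerXn2r // nnegrE; have := sqr_ge0 a; lia.
    have h27 : a * (27 * a ^+ 3) <= a * 64 by move: h9 hB; rewrite !exprMn !exprS expr0; lra.
    have : 2 ^+ 3 <= a ^+ 3 by rewrite lerXn2r ?nnegrE; lia.
    by move: h27; rewrite ler_pM2l //; lra.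
  lia.
subst a; have r0 : r' = 0 by lia.
move: hd' hB B0; rewrite r0 expr0n /= subr0 mul1r => hd' hB B0.
have b1 : b' = 1.
  have : b' < 2.
    rewrite ltNge; apply/negP => b2.
    have : 2 ^+ 2 <= b' ^+ 2 by rewrite lerXn2r ?nnegrE; lia.
    lia.
  lia.
rewrite b1 in hd' *.
apply: (gram3_add_uw (k := - s)); apply: (gram3_add_vw (k := - t')).
exists (1, 0, 0), (0, 1, 0), (0, 0, 1).
rewrite /dot /=; split; first split => //; try ring.
by have := hd'; rewrite /det3; lra.
Qed.

Definition sum3sq (n : int) : Prop :=
  exists x y z : int, n = x ^+ 2 + y ^+ 2 + z ^+ 2.

(** The quadratic form with diagonal n, A, C and off-diagonal entries e, f, be
    v has leading minor n A - e^2 = al. The integers f and C can be chosen so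
    that its determinant is 1, and it takes the value n at the first basis
    vector. *)
Lemma sum3sq_of_binary (n al be e : int) : 0 < n -> 0 < al ->
  (al %| be ^+ 2 + n)%Z -> (n %| al + e ^+ 2)%Z -> coprimez e n -> sum3sq n.
Proof.
move=> n0 al0 /dvdzP [ga hga] /dvdzP [A hA] /coprimezP [[u v] /= huv].
pose f := - (be * u).
have hB : be + e * f = n * (be * v).
  rewrite /f; have -> : be + e * - (be * u) = be * (1 - u * e) by ring.
  by rewrite -huv; ring.
have [C hC] : exists C, ga + f ^+ 2 = n * C.
  (* Modulo n the inverse of al is - u^2, since al = - e^2 and u e = 1; so it
     is enough that n divides al times the left side. *)
  have h1 : al * (ga + f ^+ 2) = n * (1 + A * f ^+ 2 + be * v * (be - e * f)).
    rewrite mulrDr [al * ga]mulrC -hga.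
    have -> : al = A * n - e ^+ 2 by rewrite -hA; ring.
    have -> : be ^+ 2 + n + (A * n - e ^+ 2) * f ^+ 2
       = n + A * n * f ^+ 2 + (be + e * f) * (be - e * f) by ring.
    by rewrite hB; ring.
  have h2 : al * u ^+ 2 = n * (A * u ^+ 2 + v * (1 + u * e)) - 1.
    have -> : al = A * n - e ^+ 2 by rewrite -hA; ring.
    have -> : (A * n - e ^+ 2) * u ^+ 2 = A * n * u ^+ 2 - (u * e) ^+ 2 by ring.
    have -> : u * e = 1 - v * n by rewrite -huv; ring.
    by ring.
  set X := ga + f ^+ 2 in h1 *.
  set Y := 1 + _ + _ in h1; set Z := A * u ^+ 2 + _ in h2.
  exists (X * Z - Y * u ^+ 2).
  have h3 : X * (al * u ^+ 2) = n * Y * u ^+ 2 by rewrite -h1; ring.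
  rewrite h2 in h3; transitivity (X * (n * Z) - X * (n * Z - 1)); first by ring.
  by rewrite h3; ring.
have hdet : n * det3 A C n (be * v) e f = n.
  have e1 : n * det3 A C n (be * v) e f =
    (n * A - e ^+ 2) * (n * C - f ^+ 2) - (n * (be * v) - e * f) ^+ 2.
    by rewrite /det3; ring.
  rewrite e1 -hC -hB.
  have -> : n * A - e ^+ 2 = al by rewrite mulrC -hA; ring.
  have -> : al * (ga + f ^+ 2 - f ^+ 2) = ga * al by ring.
  by rewrite -hga; ring.
have hd1 : det3 A C n (be * v) e f = 1.
  by apply: (mulfI (lt0r_neq0 n0)); rewrite hdet mulr1.
have A0 : 0 < A.
  by rewrite -(pmulr_lgt0 _ n0) -hA; have := sqr_ge0 e; lia.
have : gram3 n A C e f (be * v).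
  apply: gram3_unimodular => //.
  - have -> : n * A - e ^+ 2 = al by rewrite mulrC -hA; ring.
    by [].
  - by rewrite -hd1 /det3; ring.
move=> [x [y [z [[hx _ _] _ _ _]]]].
by exists x.1.1, x.1.2, x.2; rewrite -hx /dot; ring.
Qed.

(** * Hyperbola sums of periodic functions with mean zero *)

(** The real algebraic numbers form an archimedean field with square roots,
    which is all that the estimates need. *)
Local Notation R := realalg.

Definition inv_sqrt (d : nat) : R := (Num.sqrt d%:R)^-1.

Lemma inv_sqrt_ge0 d : 0 <= inv_sqrt d.
Proof. by rewrite invr_ge0 sqrtr_ge0. Qed.

Lemma inv_sqrtM d e : inv_sqrt (d * e) = inv_sqrt d * inv_sqrt e.
Proof. by rewrite /inv_sqrt natrM sqrtrM ?ler0n // invfM. Qed.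

Lemma inv_sqrt_sqr k : inv_sqrt (k ^ 2) = k%:R^-1.
Proof. by rewrite /inv_sqrt natrX sqrtr_sqr normr_nat. Qed.

Lemma inv_sqrt1 : inv_sqrt 1 = 1.
Proof. by rewrite (inv_sqrt_sqr 1) invr1. Qed.

Lemma inv_sqrt_le d e : (0 < d <= e)%N -> inv_sqrt e <= inv_sqrt d.
Proof.
move=> /andP[d0 de]; rewrite lef_pV2 ?posrE ?sqrtr_gt0 ?ltr0n //; last lia.
by rewrite ler_sqrt ?ler0n ?ler_nat.
Qed.

(** Summation by parts; w decreases, so the increments of w add up to w A - w
    B. *)
Lemma abel_bound (f w : nat -> R) (C : R) (A B : nat) :
  (forall j, (A <= j <= B)%N -> `|\sum_(A <= i < j) f i| <= C) ->
  (forall i, (A <= i)%N -> w i.+1 <= w i) -> (forall i, (A <= i)%N -> 0 <= w i) ->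
  (A <= B)%N -> `|\sum_(A <= i < B) f i * w i| <= C * w A.
Proof.
move=> hS hw w0 AB.
pose S j := \sum_(A <= i < j) f i.
have C0 : 0 <= C by apply: le_trans (hS A _); rewrite ?leqnn.
have key B' : (A <= B')%N -> \sum_(A <= i < B') f i * w i =
    S B' * w B' + \sum_(A <= i < B') S i.+1 * (w i - w i.+1).
  elim: B' => [|n IH] An.
    by move: An; rewrite leqn0 => /eqP->; rewrite /S !big_geq // mul0r addr0.
  move: An; rewrite leq_eqVlt => /predU1P [<-|].
    by rewrite /S !big_geq // mul0r addr0.
  rewrite ltnS => An; rewrite !big_nat_recr //= IH // /S big_nat_recr //=; ring.
rewrite key //.
apply: le_trans (ler_normD _ _) _.
have -> : C * w A = C * w B + C * (w A - w B) by ring.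
rewrite lerD //.
  by rewrite normrM (ger0_norm (w0 _ AB)) ler_wpM2r ?w0 // hS ?AB ?leqnn.
have -> : C * (w A - w B) = \sum_(A <= i < B) C * (w i - w i.+1).
  rewrite -mulr_sumr; congr (_ * _).
  by rewrite -opprB -(telescope_sumr _ AB) -sumrN; apply: eq_bigr => i _; rewrite opprB.
apply: le_trans (ler_norm_sum _ _ _) _; rewrite big_nat [leRHS]big_nat.
apply: ler_sum => i /andP[Ai iB].
have hwi := hw _ Ai.
by rewrite normrM (ger0_norm (x := w i - _)) ?subr_ge0 // ler_wpM2r ?subr_ge0 // hS; lia.
Qed.

Section Periodic.
Variables (N : nat) (f : nat -> R).
Hypothesis N0 : (0 < N)%N.
Hypothesis fN : forall n, f (n + N)%N = f n.
Hypothesis f1 : forall n, `|f n| <= 1.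
Hypothesis f0 : \sum_(0 <= i < N) f i = 0.

Lemma periodic_window A : \sum_(A <= i < A + N) f i = 0.
Proof.
elim: A => [|A IH]; first exact: f0.
have : \sum_(A <= i < A + N) f i + f (A + N)%N = f A + \sum_(A.+1 <= i < A.+1 + N) f i.
  by rewrite -big_nat_recr ?leq_addr //= addSn big_nat_recl // ?big_add1 //; lia.
by rewrite IH fN add0r -{1}[f A]addr0 => /addrI <-.
Qed.

Lemma periodic_sum_bound A B : `|\sum_(A <= i < B) f i| <= N%:R.
Proof.
have [n] := ubnP (B - A); elim: n A => // n IH A hn.
case: (leqP (A + N) B) => h.
  rewrite (@big_cat_nat _ _ _ (A + N)) ?leq_addr //=.
  by rewrite periodic_window add0r; apply: IH; lia.
apply: le_trans (ler_norm_sum _ _ _) _.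
apply: (@le_trans _ _ (\sum_(A <= i < B) 1)); first by apply: ler_sum.
by rewrite sumr_const_nat ler_nat; lia.
Qed.

(** Weighted sums are dominated by their first term, because the partial sums
    of f stay bounded by the period. *)
Lemma periodic_tail A B : (0 < A <= B)%N ->
  `|\sum_(A <= i < B) f i * inv_sqrt i| <= N%:R * inv_sqrt A.
Proof.
move=> /andP[A0 AB]; apply: abel_bound => //.
- by move=> j _; apply: periodic_sum_bound.
- by move=> i Ai; apply: inv_sqrt_le; lia.
- by move=> i _; apply: inv_sqrt_ge0.
Qed.

End Periodic.

(** The partial sum up to X of the Dirichlet convolution of f and g, with
    weight 1 / sqrt. *)
Definition hyperbola_sum (f g : nat -> R) (X : nat) : R :=
  \sum_(1 <= d < X.+1) \sum_(1 <= e < X.+1 | (d * e <= X)%N)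
     (f d * inv_sqrt d) * (g e * inv_sqrt e).

Lemma hyperbola_sumC f g X : hyperbola_sum f g X = hyperbola_sum g f X.
Proof.
rewrite /hyperbola_sum (exchange_big_dep_nat predT) //=.
by apply: eq_bigr => e _; apply: eq_big => [d|d _]; rewrite 1?mulnC // mulrC.
Qed.

Section Hyperbola.
Variables (N : nat) (f g : nat -> R).
Hypothesis N0 : (0 < N)%N.
Hypothesis fN : forall n, f (n + N)%N = f n.
Hypothesis f1 : forall n, `|f n| <= 1.
Hypothesis f0 : \sum_(0 <= i < N) f i = 0.
Hypothesis gN : forall n, g (n + N)%N = g n.
Hypothesis g1 : forall n, `|g n| <= 1.
Hypothesis g0 : \sum_(0 <= i < N) g i = 0.

Lemma sum_le_divn (F : nat -> R) d X : (0 < d)%N ->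
  \sum_(1 <= e < X.+1 | (d * e <= X)%N) F e = \sum_(1 <= e < (X %/ d).+1) F e.
Proof.
move=> d0; rewrite [RHS](big_nat_widen _ _ X.+1) ?ltnS ?leq_div //.
by apply: eq_bigl => e; rewrite /= ltnS leq_divRL // mulnC.
Qed.

(** Replace each inner sum by the full sum G up to Y^2. This leaves the
    product of two bounded sums, and for every d <= Y a tail starting beyond
    Y^2 / d, at most N / sqrt (Y^2 / d). With the weight 1 / sqrt d each of
    the Y tails contributes at most N / Y. *)
Lemma half_hyperbola Y : (0 < Y)%N ->
  `|\sum_(1 <= d < Y.+1) (f d * inv_sqrt d) *
     \sum_(1 <= e < (Y ^ 2 %/ d).+1) g e * inv_sqrt e| <= N%:R ^+ 2 + N%:R.
Proof.
move=> Y0; pose G := \sum_(1 <= e < (Y ^ 2).+1) g e * inv_sqrt e.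
have E : \sum_(1 <= d < Y.+1) (f d * inv_sqrt d) *
     \sum_(1 <= e < (Y ^ 2 %/ d).+1) g e * inv_sqrt e =
   (\sum_(1 <= d < Y.+1) f d * inv_sqrt d) * G -
   \sum_(1 <= d < Y.+1) (f d * inv_sqrt d) *
      \sum_((Y ^ 2 %/ d).+1 <= e < (Y ^ 2).+1) g e * inv_sqrt e.
  rewrite mulr_suml -sumrB; apply: eq_bigr => d _; rewrite -mulrBr; congr (_ * _).
  by rewrite /G (@big_cat_nat _ _ _ (Y ^ 2 %/ d).+1 1 (Y ^ 2).+1) ?addrK ?ltnS ?leq_div.
rewrite E; apply: le_trans (ler_normB _ _) _; apply: lerD.
  rewrite normrM expr2; apply: ler_pM => //.
    by apply: le_trans (periodic_tail N0 fN f1 f0 _) _; rewrite ?inv_sqrt1 ?mulr1.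
  by apply: le_trans (periodic_tail N0 gN g1 g0 _) _; rewrite ?inv_sqrt1 ?mulr1.
apply: le_trans (ler_norm_sum _ _ _) _.
apply: (@le_trans _ _ (\sum_(1 <= d < Y.+1) N%:R / Y%:R)); last first.
  rewrite sumr_const_nat subSS subn0 -[_ *+ Y]mulr_natr divfK // pnatr_eq0; lia.
rewrite big_nat [leRHS]big_nat; apply: ler_sum => d /andP[d0 dY].
rewrite !normrM (ger0_norm (inv_sqrt_ge0 d)).
have ht : `|\sum_((Y ^ 2 %/ d).+1 <= e < (Y ^ 2).+1) g e * inv_sqrt e| <=
    N%:R * inv_sqrt (Y ^ 2 %/ d).+1.
  by apply: (periodic_tail N0 gN g1 g0); rewrite /= ltnS leq_div.
have hs : inv_sqrt d * inv_sqrt (Y ^ 2 %/ d).+1 <= Y%:R^-1.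
  rewrite -inv_sqrtM -inv_sqrt_sqr; apply: inv_sqrt_le.
  by rewrite expn_gt0 Y0 /= ltnW // mulnC -ltn_divLR.
apply: (@le_trans _ _ (1 * inv_sqrt d * (N%:R * inv_sqrt (Y ^ 2 %/ d).+1))).
  by apply: ler_pM => //; rewrite ?mulr_ge0 ?inv_sqrt_ge0 // ler_wpM2r ?inv_sqrt_ge0.
by rewrite mul1r mulrCA ler_wpM2l.
Qed.

End Hyperbola.

(** Dirichlet's hyperbola method: if d e <= Y^2 then d <= Y or e <= Y, and the
    pairs satisfying both are counted twice. The bound does not depend on
    Y. *)
Lemma hyperbola_sum_bound N f g Y : (0 < N)%N ->
  (forall n, f (n + N)%N = f n) -> (forall n, `|f n| <= 1) ->
  \sum_(0 <= i < N) f i = 0 ->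
  (forall n, g (n + N)%N = g n) -> (forall n, `|g n| <= 1) ->
  \sum_(0 <= i < N) g i = 0 -> (0 < Y)%N ->
  `|hyperbola_sum f g (Y ^ 2)| <= 3 * N%:R ^+ 2 + 2 * N%:R.
Proof.
move=> N0 fN f1 f0 gN g1 g0 Y0.
have YY : (Y <= Y ^ 2)%N by rewrite expnS expn1 leq_pmulr.
pose a d := f d * inv_sqrt d; pose b e := g e * inv_sqrt e.
have E : hyperbola_sum f g (Y ^ 2) =
  \sum_(1 <= d < Y.+1) a d * (\sum_(1 <= e < (Y ^ 2 %/ d).+1) b e) +
  \sum_(1 <= e < Y.+1) b e * (\sum_(1 <= d < (Y ^ 2 %/ e).+1) a d) -
  (\sum_(1 <= d < Y.+1) a d) * (\sum_(1 <= e < Y.+1) b e).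
  rewrite /hyperbola_sum (@big_cat_nat _ _ _ Y.+1) //= -addrA; congr (_ + _).
    rewrite big_nat [RHS]big_nat; apply: eq_bigr => d /andP[d0 _].
    by rewrite -mulr_sumr sum_le_divn.
  rewrite (exchange_big_dep_nat predT) //=.
  rewrite (@big_cat_nat _ _ _ Y.+1) //= [X in _ + X]big1_seq ?addr0; last first.
    move=> e /andP[_]; rewrite mem_index_iota => /andP[Ye _].
    rewrite big_nat_cond big1 // => d /andP[/andP[Yd _] hde]; exfalso.
    by move: hde; rewrite leqNgt => /negP; apply; rewrite expnS expn1 ltn_mul.
  rewrite mulr_sumr -sumrB big_nat [RHS]big_nat; apply: eq_bigr => e /andP[e0 eY].
  rewrite ltnS in eY.
  have hdiv : (Y <= Y ^ 2 %/ e)%N by rewrite leq_divRL // expnS expn1 leq_mul2l eY orbT.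
  have -> : \sum_(1 <= d < (Y ^ 2 %/ e).+1) a d =
     \sum_(1 <= d < Y.+1) a d + \sum_(Y.+1 <= d < (Y ^ 2 %/ e).+1) a d.
    by rewrite (@big_cat_nat _ _ _ Y.+1).
  rewrite mulrDr [_ * b e]mulrC addrAC subrr add0r mulr_sumr.
  rewrite [RHS](big_nat_widen _ _ (Y ^ 2).+1) ?ltnS ?leq_div //.
  by apply: eq_big => [d|d _]; [rewrite /= ltnS leq_divRL | rewrite mulrC].
rewrite E; apply: le_trans (ler_normB _ _) _.
have h1 := half_hyperbola N0 fN f1 f0 gN g1 g0 Y0.
have h2 := half_hyperbola N0 gN g1 g0 fN f1 f0 Y0.
have h3 : `|(\sum_(1 <= d < Y.+1) a d) * (\sum_(1 <= e < Y.+1) b e)| <= N%:R ^+ 2.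
  rewrite normrM expr2; apply: ler_pM => //.
    by apply: le_trans (periodic_tail N0 fN f1 f0 _) _; rewrite ?inv_sqrt1 ?mulr1.
  by apply: le_trans (periodic_tail N0 gN g1 g0 _) _; rewrite ?inv_sqrt1 ?mulr1.
have -> : 3 * N%:R ^+ 2 + 2 * N%:R = (N%:R ^+ 2 + N%:R) + (N%:R ^+ 2 + N%:R) + N%:R ^+ 2 :> R by ring.
by apply: lerD => //; apply: le_trans (ler_normD _ _) _; apply: lerD.
Qed.

(** * Divisor sums of a quadratic character *)

Lemma sum_divisors (F : nat -> R) q X : (0 < q <= X)%N ->
  \sum_(d <- divisors q) F d = \sum_(1 <= d < X.+1 | (d %| q)%N) F d.
Proof.
move=> /andP[q0 qX]; rewrite -[RHS]big_filter; apply: perm_big; apply: uniq_perm.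
- exact: divisors_uniq.
- by rewrite filter_uniq // iota_uniq.
move=> d; rewrite -dvdn_divisors // mem_filter mem_index_iota.
case: (boolP (d %| q)%N) => //= dq; rewrite (dvdn_gt0 q0 dq) ltnS.
by rewrite (leq_trans (dvdn_leq q0 dq)).
Qed.

(** Collect the pairs (d, e) by their product q = d e. *)
Lemma sum_pairs_divisors (H : nat -> nat -> R) X :
  \sum_(1 <= d < X.+1) \sum_(1 <= e < X.+1 | (d * e <= X)%N) H d e =
  \sum_(1 <= q < X.+1) \sum_(d <- divisors q) H d (q %/ d)%N.
Proof.
transitivity (\sum_(1 <= d < X.+1) \sum_(1 <= q < X.+1 | (d %| q)%N) H d (q %/ d)%N).
  rewrite big_nat [RHS]big_nat; apply: eq_bigr => d /andP[d0 _].
  rewrite sum_le_divn // -[RHS]big_filter.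
  have -> : \sum_(i <- [seq q <- index_iota 1 X.+1 | (d %| q)%N]) H d (i %/ d)%N =
     \sum_(i <- [seq d * e | e <- index_iota 1 (X %/ d).+1]%N) H d (i %/ d)%N.
    apply: perm_big; apply: uniq_perm.
    - by rewrite filter_uniq // iota_uniq.
    - rewrite map_inj_uniq ?iota_uniq // => x y /eqP.
      by rewrite eqn_pmul2l // => /eqP.
    move=> q; rewrite mem_filter mem_index_iota; apply/andP/mapP.
      case=> /dvdnP [e ->]; rewrite muln_gt0 ltnS => /andP[/andP[e0 _] h].
      by exists e; rewrite ?mem_index_iota ?e0 ?ltnS ?leq_divRL // mulnC.
    case=> e; rewrite mem_index_iota ltnS => /andP[e0 he] ->.
    rewrite dvdn_mulr // muln_gt0 d0 e0 ltnS mulnC.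
    by rewrite -leq_divRL.
  by rewrite big_map; apply: eq_bigr => e _; rewrite mulKn.
rewrite (exchange_big_dep_nat predT) //= big_nat [RHS]big_nat.
apply: eq_bigr => q /andP[q0 qX].
by rewrite (sum_divisors (fun d => H d (q %/ d)%N) (X := X)) // q0 -ltnS.
Qed.

Lemma sum_divisors_pfactor (F : nat -> R) p a m :
  prime p -> coprime p m -> (0 < m)%N ->
  \sum_(d <- divisors (p ^ a * m)) F d =
  \sum_(0 <= i < a.+1) \sum_(d <- divisors m) F (p ^ i * d)%N.
Proof.
move=> pp cpm m0; have p0 := prime_gt0 pp.
have pa0 : (0 < p ^ a * m)%N by rewrite muln_gt0 expn_gt0 p0.
rewrite -(big_allpairs_dep (h := fun i d => (p ^ i * d)%N)).
apply: perm_big; apply: uniq_perm; first exact: divisors_uniq.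
  apply: (@allpairs_uniq _ _ _ (fun i d => p ^ i * d)%N); [exact: iota_uniq|exact: divisors_uniq|].
  move=> [i d] [j e] /allpairsPdep [i' [d' [_ hd [-> ->]]]].
  move=> /allpairsPdep [j' [e' [_ he [-> ->]]]] /= E.
  rewrite -dvdn_divisors // in hd; rewrite -dvdn_divisors // in he.
  have cd : coprime p d' by apply: coprime_dvdr hd _.
  have ce : coprime p e' by apply: coprime_dvdr he _.
  have Eij : i' = j'.
    move/(congr1 (logn p)): E.
    rewrite !lognM ?expn_gt0 ?p0 ?(dvdn_gt0 m0) // !pfactorK //.
    by rewrite !logn_coprime ?addn0.
  move: E; rewrite Eij => /eqP; rewrite eqn_pmul2l ?expn_gt0 ?p0 // => /eqP ->.
  by [].
move=> x; rewrite -dvdn_divisors //; apply/idP/(@allpairsP _ _ _ (fun i d => p ^ i * d)%N).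
  move=> hx; have x0 := dvdn_gt0 pa0 hx.
  have [y cy ey] := pfactor_coprime pp x0.
  exists (logn p x, y); split => //=; last by rewrite mulnC.
    rewrite mem_index_iota ltnS /=.
    have := dvdn_leq_log p pa0 hx.
    by rewrite lognM ?expn_gt0 ?p0 // pfactorK // (logn_coprime cpm) addn0.
  rewrite -dvdn_divisors //; have : (y %| p ^ a * m)%N.
    by apply: dvdn_trans hx; rewrite ey dvdn_mulr.
  by rewrite Gauss_dvdr // coprime_sym coprimeXl.
case=> -[i d] /= []; rewrite mem_index_iota ltnS -dvdn_divisors // => ia dm ->.
by rewrite dvdn_mul // dvdn_exp2l.
Qed.

Definition square_free (n : nat) := forall p, prime p -> ~~ (p ^ 2 %| n)%N.

Section CharacterDivisorSum.
Variables (N : nat) (chi : nat -> R).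
Hypothesis chiM : forall m n, chi (m * n)%N = chi m * chi n.
Hypothesis chi1 : chi 1%N = 1.
Hypothesis chiU : forall n, coprime N n -> chi n ^+ 2 = 1.

Definition divisor_sum (q : nat) : R := \sum_(d <- divisors q) chi d.

Lemma chiX n k : chi (n ^ k)%N = chi n ^+ k.
Proof. by elim: k => [|k IH]; rewrite ?expn0 ?chi1 // expnS chiM IH exprS. Qed.

Lemma divisor_sum_pfactor p a m : prime p -> coprime p m -> (0 < m)%N ->
  divisor_sum (p ^ a * m) = (\sum_(0 <= i < a.+1) chi p ^+ i) * divisor_sum m.
Proof.
move=> pp cpm m0; rewrite /divisor_sum sum_divisors_pfactor // mulr_suml.
apply: eq_bigr => i _; rewrite mulr_sumr; apply: eq_bigr => d _.
by rewrite chiM chiX.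
Qed.

Lemma chi_pm n : coprime N n -> chi n = 1 \/ chi n = -1.
Proof.
by move=> /chiU /eqP; rewrite sqrf_eq1 => /orP[] /eqP; [left|right].
Qed.

Lemma alternating_sum a : \sum_(0 <= i < a.+1) (-1 : R) ^+ i = (~~ odd a)%:R.
Proof.
elim: a => [|a IH]; first by rewrite big_nat1.
rewrite big_nat_recr //= IH negbK exprS -signr_odd.
by case: (odd a); rewrite ?expr1 ?expr0 /=; ring.
Qed.

(** Induction over the factorisation into coprime prime powers, the form
    suited to multiplicative functions. *)
Lemma pfactor_ind (P : nat -> Prop) : P 1%N ->
  (forall p a m, prime p -> (0 < a)%N -> (0 < m)%N -> coprime p m -> P m ->
     P (p ^ a * m)%N) ->
  forall n, (0 < n)%N -> P n.
Proof.
move=> P1 PS n; have [k] := ubnP n; elim: k n => // k IH n hn n0.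
case: (ltngtP n 1%N) => [|n1|->] //; first lia.
have pp := pdiv_prime n1; have [m cm em] := pfactor_coprime pp n0.
have m0 : (0 < m)%N by move: n0; rewrite em muln_gt0 => /andP[].
have a0 : (0 < logn (pdiv n) n)%N by rewrite logn_gt0 mem_primes pp n0 pdiv_dvd.
rewrite em mulnC; apply: PS => //; apply: IH => //.
apply: (@leq_trans n); last by [].
rewrite [leqRHS]em ltn_Pmulr //.
by rewrite -(exp1n (logn (pdiv n) n)) ltn_exp2r // prime_gt1.
Qed.

(** The factor at p^a is 1 + chi(p) + ... + chi(p)^a, which is a + 1, 1 or
    0. *)
Lemma divisor_sum_ge0 q : (0 < q)%N -> coprime N q -> 0 <= divisor_sum q.
Proof.
move: q; apply: pfactor_ind => [_|p a m pp a0 m0 cpm IH].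
  by rewrite /divisor_sum big_seq1 chi1.
rewrite coprimeMr coprime_pexpr // => /andP[Np Nm].
rewrite divisor_sum_pfactor // mulr_ge0 ?IH //.
have [->|->] := chi_pm Np; last by rewrite alternating_sum.
by apply: sumr_ge0 => i _; rewrite expr1n.
Qed.

(** At an even exponent the factor is a + 1 or 1. *)
Lemma divisor_sum_sqr_ge1 k : (0 < k)%N -> coprime N k -> 1 <= divisor_sum (k ^ 2).
Proof.
move: k; apply: pfactor_ind => [_|p a m pp a0 m0 cpm IH].
  by rewrite /divisor_sum big_seq1 chi1.
rewrite coprimeMr coprime_pexpr // => /andP[Np Nm].
rewrite expnMn -expnM divisor_sum_pfactor ?coprimeXr ?expn_gt0 ?m0 //.
rewrite -[1]mulr1; apply: ler_pM => //; last exact: IH.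
have [->|->] := chi_pm Np; last by rewrite alternating_sum muln2 odd_double.
rewrite (eq_bigr (fun=> 1)) => [|i _]; last by rewrite expr1n.
by rewrite sumr_const_nat ler1n.
Qed.

(** The factor at p^a vanishes exactly when chi(p) = -1 and a is odd. So every
    prime with odd exponent has chi(p) = 1, and d is the product of these
    primes. *)
Lemma divisor_sum_neq0 q : (0 < q)%N -> coprime N q -> divisor_sum q != 0 ->
  exists d f, [/\ q = (d * f ^ 2)%N, square_free d &
                  forall p, prime p -> (p %| d)%N -> chi p = 1].
Proof.
move: q; apply: pfactor_ind => [_ _|p a m pp a0 m0 cpm IH].
  exists 1%N, 1%N; split => // p pp; last by rewrite dvdn1 => /eqP e; rewrite e in pp.
  by rewrite dvdn1 -(exp1n 2) eqn_exp2r // neq_ltn prime_gt1 // orbT.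
rewrite coprimeMr coprime_pexpr // => /andP[Np Nm].
rewrite divisor_sum_pfactor // mulf_eq0 negb_or => /andP[hs hm].
have [d [f [em sd hd]]] := IH Nm hm.
have aE := odd_double_half a.
case: (boolP (odd a)) => oa; rewrite ?oa ?(negbTE oa) /= in aE; last first.
  exists d, (p ^ (a./2) * f)%N; split => //.
  by rewrite em expnMn -expnM muln2 -{1}aE add0n mulnCA.
have cp : chi p = 1.
  case: (chi_pm Np) => // e; move: hs; rewrite e alternating_sum oa eqxx //.
have dm : (d %| m)%N by rewrite em dvdn_mulr.
exists (p * d)%N, (p ^ (a./2) * f)%N; split.
- rewrite em expnMn -expnM muln2 -{1}aE add1n expnS; lia.
- move=> r pr; apply/negP => h; case: (eqVneq r p) => [e|ne].
    move: h; rewrite e expnS expn1 dvdn_pmul2l ?prime_gt0 // => pd.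
    have := dvdn_trans pd dm; have := cpm; rewrite prime_coprime // => /negP.
    by [].
  move: h; rewrite Gauss_dvdr; first by rewrite (negbTE (sd r pr)).
  by rewrite coprime_pexpl // prime_coprime // dvdn_prime2.
move=> r pr; rewrite Euclid_dvdM // => /orP[|]; last exact: hd.
by rewrite dvdn_prime2 // => /eqP ->.
Qed.

End CharacterDivisorSum.

(** * Square-free numbers with prescribed quadratic characters *)

Lemma ler_sum_subseq (T : eqType) (s' s : seq T) (g : T -> R) :
  uniq s -> uniq s' -> {subset s' <= s} -> (forall x, x \in s -> 0 <= g x) ->
  \sum_(x <- s') g x <= \sum_(x <- s) g x.
Proof.
move=> us us' sub g0.
have -> : \sum_(x <- s') g x = \sum_(x <- s | x \in s') g x.
  rewrite -[RHS]big_filter; apply: perm_big; apply: uniq_perm => //.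
    exact: filter_uniq.
  by move=> x; rewrite mem_filter; case: (boolP (x \in s')) => // /sub ->.
rewrite [leRHS](bigID (mem s')) /= lerDl big_seq_cond.
by apply: sumr_ge0 => x /andP[xs _]; apply: g0.
Qed.

(** The terms between 2^a and 2^(a+1) add up to at least 1 / 2. *)
Lemma harmonic_dyadic a : (a%:R / 2 : R) <= \sum_(0 <= j < 2 ^ a) j.+1%:R^-1.
Proof.
elim: a => [|a IH]; first by rewrite mul0r big_nat1 invr1 ler01.
rewrite (@big_cat_nat _ _ _ (2 ^ a)) ?leq_exp2l //=.
rewrite -natr1 mulrDl lerD //.
apply: (@le_trans _ _ (\sum_(2 ^ a <= j < 2 ^ a.+1) (2 ^ a.+1)%:R^-1)).
  rewrite sumr_const_nat expnS mul2n -addnn addnK -[leRHS]mulr_natr natrD.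
  have : (2 ^ a)%:R != 0 :> R by rewrite pnatr_eq0 expn_eq0.
  move: (2 ^ a)%:R => b hb.
  suff -> : (b + b)^-1 * b = 1 / 2 by [].
  have -> : b + b = 2 * b by ring.
  by rewrite invfM -mulrA mulVf // mulr1 mul1r.
rewrite [leLHS]big_nat [leRHS]big_nat; apply: ler_sum => j /andP[_ hj].
by rewrite lef_pV2 ?posrE ?ltr0n ?expn_gt0 // ler_nat.
Qed.

(** Keep only k = N j + 1, which is coprime to N and at most N (j + 1). *)
Lemma coprime_harmonic_unbounded N (C : R) : (0 < N)%N ->
  exists2 Y, (0 < Y)%N & C < \sum_(1 <= k < Y.+1) (coprime N k)%:R / k%:R.
Proof.
move=> N0; pose a := Num.bound (2 * N%:R * `|C|).
have hN : 0 < N%:R :> R by rewrite ltr0n.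
exists (N * 2 ^ a)%N; first by rewrite muln_gt0 N0 expn_gt0.
have ha : 2 * N%:R * `|C| < a%:R.
  by apply: archi_boundP; rewrite !mulr_ge0 ?ler0n.
apply: le_lt_trans (ler_norm C) _.
apply: (@lt_le_trans _ _ (N%:R^-1 * (a%:R / 2))).
  by rewrite -(ltr_pM2l hN) mulVKf ?gt_eqF //; lra.
apply: (@le_trans _ _ (N%:R^-1 * \sum_(0 <= j < 2 ^ a) j.+1%:R^-1)).
  by rewrite ler_wpM2l ?invr_ge0 ?ler0n // harmonic_dyadic.
rewrite mulr_sumr.
apply: (@le_trans _ _ (\sum_(0 <= j < 2 ^ a) (coprime N (N * j + 1))%:R / (N * j + 1)%:R)).
  apply: ler_sum => j _.
  have -> : coprime N (N * j + 1) by rewrite /coprime mulnC gcdnMDl gcdn1.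
  rewrite div1r -invfM lef_pV2 ?posrE ?mulr_gt0 ?ltr0n //; last by rewrite addn1.
  by rewrite -natrM ler_nat; nia.
rewrite -(big_map (fun j => N * j + 1)%N predT (fun k => (coprime N k)%:R / k%:R)).
apply: ler_sum_subseq.
- exact: iota_uniq.
- rewrite map_inj_uniq ?iota_uniq // => x y /eqP.
  by rewrite eqn_add2r eqn_pmul2l // => /eqP.
- move=> k /mapP [j]; rewrite !mem_index_iota => /andP[_ hj] ->.
  by rewrite addn1 ltn0Sn !ltnS ltn_pmul2l.
- by move=> k _; rewrite divr_ge0 ?ler0n.
Qed.

Section Characters.
Variables (I : finType) (N : nat) (lam : I -> nat -> R).
Hypothesis N0 : (0 < N)%N.
Hypothesis lamM : forall i m n, lam i (m * n)%N = lam i m * lam i n.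
Hypothesis lam1 : forall i, lam i 1%N = 1.
Hypothesis lamN : forall i n, lam i (n + N)%N = lam i n.
Hypothesis lamU : forall i n, coprime N n -> lam i n ^+ 2 = 1.
Hypothesis lam_indep : forall i, exists u,
  [/\ coprime N u, lam i u = -1 & forall j, j != i -> lam j u = 1].

(** The character attached to a subset J of the indices, made zero off the
    integers coprime to N. *)
Definition subchar (J : {set I}) (n : nat) : R :=
  (coprime N n)%:R * \prod_i (if i \in J then lam i n else 1).

Lemma subcharM J m n : subchar J (m * n) = subchar J m * subchar J n.
Proof.
rewrite /subchar coprimeMr -mulnb natrM mulrACA -big_split /=.
congr (_ * _); apply: eq_bigr => i _; case: ifP => _ //.
by rewrite mulr1.
Qed.

Lemma subcharN J n : subchar J (n + N)%N = subchar J n.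
Proof.
rewrite /subchar /coprime gcdnDr; congr (_ * _).
by apply: eq_bigr => i _; rewrite lamN.
Qed.

Lemma subchar_norm J n : `|subchar J n| <= 1.
Proof.
rewrite /subchar; case: (boolP (coprime N n)) => [cn|_]; last by rewrite mul0r normr0.
rewrite mul1r normr_prod big1 // => i _; case: ifP => _; last exact: normr1.
by apply/eqP; rewrite -sqr_norm_eq1 ?lamU // -normrX lamU ?normr1.
Qed.

Lemma subchar_mod J n : subchar J (n %% N)%N = subchar J n.
Proof.
rewrite {2}(divn_eq n N); elim: (n %/ N)%N => [|k IH]; first by rewrite mul0n.
by rewrite mulSn -addnA addnC subcharN -IH.
Qed.

(** Multiplication by u permutes the residues modulo N and changes the sign of
    every term. *)
Lemma subchar_sum0 J : J != set0 -> \sum_(0 <= n < N) subchar J n = 0.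
Proof.
case/set0Pn => i iJ; have [u [cu hu hj]] := lam_indep i.
have fu : subchar J u = -1.
  rewrite /subchar cu mul1r (bigD1 i) //= iJ hu big1 ?mulr1 // => j ji.
  by rewrite hj //; case: ifP.
have h (k : 'I_N) : (u * k %% N < N)%N by rewrite ltn_pmod.
pose s (k : 'I_N) := Ordinal (h k).
have s_inj : injective s.
  move=> k l /(congr1 val) /= /eqP E; apply: val_inj => /=.
  wlog kl : k l E / (k <= l)%N.
    by move=> W; case: (leqP k l) => [|/ltnW] hkl; [apply: W|apply/esym/W; rewrite 1?eq_sym].
  move: E; rewrite eq_sym eqn_mod_dvd ?leq_mul2l ?kl ?orbT // -mulnBr Gauss_dvdr //.
  move=> /dvdn_leq hd; apply/eqP; rewrite eqn_leq kl /= -subn_eq0.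
  rewrite -leqn0 leqNgt; apply/negP => /hd; have := ltn_ord l; lia.
have E : \sum_(0 <= n < N) subchar J n = - \sum_(0 <= n < N) subchar J n.
  rewrite big_mkord {1}(reindex_inj s_inj) -sumrN; apply: eq_bigr => k _ /=.
  by rewrite subchar_mod subcharM fu mulN1r.
lra.
Qed.

Variable eps : I -> R.
Hypothesis eps2 : forall i, eps i ^+ 2 = 1.
Hypothesis eps_prod : \prod_i eps i = 1.
Hypothesis I0 : (0 < #|I|)%N.

Let chi n := \prod_i lam i n.

Definition eps_set (J : {set I}) : R := \prod_i (if i \in J then eps i else 1).

(** Expand the product over the subsets J. For q = d e coprime to N, the
    J-part of the characters at q times chi(d) is the product of the
    characters in J at e and of those outside J at d, since lam i(d)^2 = 1. *)
Lemma weighted_expansion X :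
  \sum_(1 <= q < X.+1) (coprime N q)%:R * inv_sqrt q *
     (\prod_i (1 + eps i * lam i q)) * divisor_sum chi q =
  \sum_(J : {set I}) eps_set J * hyperbola_sum (subchar (~: J)) (subchar J) X.
Proof.
transitivity (\sum_(1 <= q < X.+1) \sum_(d <- divisors q)
   (fun d e => \sum_(J : {set I}) eps_set J *
     ((subchar (~: J) d * inv_sqrt d) * (subchar J e * inv_sqrt e))) d (q %/ d)%N).
  rewrite big_nat [RHS]big_nat; apply: eq_bigr => q /andP[q0 _].
  rewrite /divisor_sum mulr_sumr big_seq [RHS]big_seq; apply: eq_bigr => d.
  rewrite -dvdn_divisors // => dq; have := divnK dq.
  set e := (q %/ d)%N => /esym; rewrite mulnC => ->.
  rewrite (eq_bigr (fun i => eps i * (lam i d * lam i e) + 1)); last first.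
    by move=> i _; rewrite lamM addrC.
  rewrite bigA_distr mulr_sumr mulr_suml; apply: eq_bigr => J _.
  rewrite inv_sqrtM /subchar /eps_set /chi coprimeMr.
  case: (boolP (coprime N d)) => cd; last by rewrite !(mul0r, mulr0).
  case: (boolP (coprime N e)) => ce; last by rewrite !(mul0r, mulr0).
  rewrite !mul1r.
  transitivity (inv_sqrt d * inv_sqrt e * ((\prod_i (if i \in J then eps i * (lam i d * lam i e) else 1)) *
     \prod_i lam i d)); first by ring.
  transitivity (inv_sqrt d * inv_sqrt e *
     ((\prod_i (if i \in J then eps i else 1)) *
     ((\prod_i (if i \in ~: J then lam i d else 1)) *
     \prod_i (if i \in J then lam i e else 1)))); last by ring.
  congr (_ * _); rewrite -!big_split /=; apply: eq_bigr => i _.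
  rewrite in_setC; case: ifP => _ /=; last by rewrite !(mul1r, mulr1).
  transitivity (eps i * lam i e * lam i d ^+ 2); first by ring.
  by rewrite lamU //; ring.
rewrite -(sum_pairs_divisors (fun d e => \sum_(J : {set I}) eps_set J *
     ((subchar (~: J) d * inv_sqrt d) * (subchar J e * inv_sqrt e)))).
under eq_bigr do rewrite exchange_big /=.
rewrite exchange_big /=; apply: eq_bigr => J _; rewrite /hyperbola_sum mulr_sumr.
by apply: eq_bigr => d _; rewrite mulr_sumr.
Qed.

(** All terms of the divisor sum are nonnegative, and those at q = k^2 are at
    least 1 / k. *)
Lemma main_term_lower Y : (0 < Y)%N ->
  \sum_(1 <= k < Y.+1) (coprime N k)%:R / k%:R <=
  hyperbola_sum (subchar setT) (subchar set0) (Y ^ 2).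
Proof.
move=> Y0.
have chiM m n : chi (m * n)%N = chi m * chi n.
  by rewrite /chi -big_split; apply: eq_bigr => i _; rewrite lamM.
have chi1 : chi 1%N = 1 by rewrite /chi big1.
have chiU n : coprime N n -> chi n ^+ 2 = 1.
  by move=> cn; rewrite /chi -prodrXl big1 // => i _; rewrite lamU.
have -> : hyperbola_sum (subchar setT) (subchar set0) (Y ^ 2) =
  \sum_(1 <= q < (Y ^ 2).+1) (coprime N q)%:R * inv_sqrt q * divisor_sum chi q.
  rewrite /hyperbola_sum (sum_pairs_divisors (fun d e =>
     subchar setT d * inv_sqrt d * (subchar set0 e * inv_sqrt e))).
  rewrite big_nat [RHS]big_nat; apply: eq_bigr => q /andP[q0 _].
  rewrite /divisor_sum mulr_sumr big_seq [RHS]big_seq; apply: eq_bigr => d.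
  rewrite -dvdn_divisors // => dq; have := divnK dq.
  set e := (q %/ d)%N => /esym; rewrite mulnC => ->.
  rewrite inv_sqrtM coprimeMr -mulnb natrM /subchar /chi.
  rewrite (eq_bigr (lam^~ d)) => [|i _]; last by rewrite inE.
  rewrite [\prod_i (if i \in set0 then _ else _)]big1 => [|i _]; last by rewrite inE.
  by ring.
have g0 q : q \in index_iota 1 (Y ^ 2).+1 ->
   0 <= (coprime N q)%:R * inv_sqrt q * divisor_sum chi q.
  rewrite mem_index_iota => /andP[q0 _].
  case: (boolP (coprime N q)) => cq; last by rewrite !mul0r.
  by rewrite mulr_ge0 ?(divisor_sum_ge0 chiM chi1 chiU) // mul1r inv_sqrt_ge0.
apply: (@le_trans _ _ (\sum_(q <- [seq k ^ 2 | k <- index_iota 1 Y.+1]%N)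
   (coprime N q)%:R * inv_sqrt q * divisor_sum chi q)); last first.
  apply: ler_sum_subseq => //; first exact: iota_uniq.
    by rewrite map_inj_uniq ?iota_uniq // => x y /eqP; rewrite eqn_exp2r // => /eqP.
  move=> q /mapP [k]; rewrite !mem_index_iota => /andP[k0 hk] ->.
  by rewrite expn_gt0 k0 ltnS leq_exp2r.
rewrite big_map [leLHS]big_nat [leRHS]big_nat; apply: ler_sum => k /andP[k0 _].
rewrite coprime_pexpr // inv_sqrt_sqr.
case: (boolP (coprime N k)) => ck; last by rewrite !mul0r.
by rewrite ler_peMr ?mulr_ge0 ?invr_ge0 ?ler0n // (divisor_sum_sqr_ge1 chiM chi1 chiU).
Qed.

(** In the expansion of the weighted sum the terms J = set0 and J = setT are
    equal, by symmetry of hyperbola sums and because the product of the eps i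
    is 1. They are unbounded, the other terms are bounded, so some q has a
    nonzero weight. The conclusion at the primes of d shows that the condition
    on the product of the eps i is necessary. *)
Lemma prescribed_characters : exists d,
  [/\ (0 < d)%N, coprime N d, square_free d, forall i, lam i d = eps i &
      forall p, prime p -> (p %| d)%N -> \prod_i lam i p = 1].
Proof.
pose C : R := 3 * N%:R ^+ 2 + 2 * N%:R.
have C0 : 0 <= C by rewrite addr_ge0 ?mulr_ge0 ?exprn_ge0 ?ler0n.
pose M : R := #|{set I}|%:R.
have [Y Y0 hY] := coprime_harmonic_unbounded (M * C) N0.
have hT := main_term_lower Y0.
pose T := hyperbola_sum (subchar setT) (subchar set0) (Y ^ 2).
have T_gt : M * C < T by apply: lt_le_trans hT.
have hmain := weighted_expansion (Y ^ 2).
have ne0T : setT != set0 :> {set I}.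
  by apply/set0Pn; case/card_gt0P: I0 => i _; exists i; rewrite inE.
rewrite (bigD1 set0) //= (bigD1 setT) //= setC0 setCT in hmain.
rewrite [hyperbola_sum (subchar set0) _ _]hyperbola_sumC -/T in hmain.
have e0 : eps_set set0 = 1 by rewrite /eps_set big1 // => i _; rewrite inE.
have eT : eps_set setT = 1.
  by rewrite -eps_prod; apply: eq_bigr => i _; rewrite inE.
have epsN J : `|eps_set J| = 1.
  rewrite /eps_set normr_prod big1 // => i _; case: ifP => _; last exact: normr1.
  by apply/eqP; rewrite -sqr_norm_eq1 ?eps2 // -normrX eps2 ?normr1.
rewrite e0 eT !mul1r in hmain.
set rest := \sum_(J | _) _ in hmain.
have hrest : `|rest| <= M * C.
  apply: le_trans (ler_norm_sum _ _ _) _.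
  apply: (@le_trans _ _ (\sum_(J : {set I}) C)); last first.
    by rewrite sumr_const -mulr_natl.
  rewrite [leRHS](bigID (fun J : {set I} => (J != set0) && (J != setT))) /=.
  rewrite -[leLHS]addr0; apply: lerD; last exact: sumr_ge0.
  apply: ler_sum => J /andP[J0 JT]; rewrite normrM epsN mul1r.
  apply: hyperbola_sum_bound => //; try exact: subcharN; try exact: subchar_norm.
    by apply: subchar_sum0; rewrite -subset0 subCset setC0 subTset.
  exact: subchar_sum0.
have : \sum_(1 <= q < (Y ^ 2).+1) (coprime N q)%:R * inv_sqrt q *
     (\prod_i (1 + eps i * lam i q)) * divisor_sum chi q != 0.
  rewrite hmain; apply: lt0r_neq0; move: hrest; rewrite ler_norml => /andP[h1 _].
  have := mulr_ge0 (ler0n R #|{set I}|) C0; rewrite -/M; lra.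
move=> /eqP hne; have : exists2 q, (0 < q)%N & (coprime N q)%:R * inv_sqrt q *
     (\prod_i (1 + eps i * lam i q)) * divisor_sum chi q != 0.
  case: (boolP (has (fun q => (coprime N q)%:R * inv_sqrt q *
     (\prod_i (1 + eps i * lam i q)) * divisor_sum chi q != 0) (index_iota 1 (Y ^ 2).+1))).
    by case/hasP => q; rewrite mem_index_iota => /andP[q0 _] h; exists q.
  move=> /hasPn hall; case: hne; rewrite big_seq big1 // => q /hall.
  by rewrite negbK => /eqP.
case=> q q0; rewrite !mulf_eq0 !negb_or -!andbA => /and4P[cq _ hp hd].
have {}cq : coprime N q by move: cq; case: coprime => //; rewrite eqxx.
have chiM m n : chi (m * n)%N = chi m * chi n.
  by rewrite /chi -big_split; apply: eq_bigr => i _; rewrite lamM.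
have chi1 : chi 1%N = 1 by rewrite /chi big1.
have chiU n : coprime N n -> chi n ^+ 2 = 1.
  by move=> cn; rewrite /chi -prodrXl big1 // => i _; rewrite lamU.
have [d [f [eq_q sd hpd]]] := divisor_sum_neq0 chiM chi1 chiU q0 cq hd.
move: cq; rewrite eq_q coprimeMr coprime_pexpr // => /andP[cd cf].
have d0 : (0 < d)%N by move: q0; rewrite eq_q muln_gt0 => /andP[].
exists d; split => // i.
have hi : lam i q = lam i d by rewrite eq_q !lamM -expr2 lamU // mulr1.
have : 1 + eps i * lam i d != 0.
  by move/prodf_neq0: hp => /(_ i isT); rewrite hi.
have /eqP := lamU i cd; have /eqP := eps2 i; rewrite !sqrf_eq1.
by move=> /orP[] /eqP -> /orP[] /eqP -> //; rewrite ?mulrN1 ?mulN1r ?mulr1 ?subrr ?eqxx.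
Qed.

End Characters.

(** * The quadratic character of a finite field of odd order *)

Section QuadraticCharacter.
Variable F : finFieldType.
Hypothesis Fodd : odd #|F|.

Definition qchar (x : F) : int :=
  if x == 0 then 0 else if [exists y, y ^+ 2 == x] then 1 else -1.

Local Notation h := (#|F|.-1)./2.

Lemma card_half : #|F|.-1 = (h * 2)%N.
Proof.
have := odd_double_half #|F|.-1; have : (1 < #|F|)%N by apply: finNzRing_gt1.
have -> : odd #|F|.-1 = false.
  by move: Fodd; case: (#|F|) => //= n; case: odd.
by rewrite add0n muln2 => _ ->.
Qed.

Lemma expf_card1 (x : F) : x != 0 -> x ^+ #|F|.-1 = 1.
Proof.
move=> x0; apply: (mulfI x0); rewrite -exprS mulr1 prednK ?expf_card //.
by apply/card_gt0P; exists 0.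
Qed.

Lemma prim_root_finField : exists g : F, (#|F|.-1).-primitive_root g.
Proof.
have F1 : (1 < #|F|)%N by apply: finNzRing_gt1.
have /hasP [g _ hg] : has (#|F|.-1).-primitive_root (enum (predC1 (0 : F))).
  apply: has_prim_root; first lia.
  - by apply/allP => x; rewrite mem_enum unity_rootE => /expf_card1 ->.
  - exact: enum_uniq.
  - by rewrite -cardE cardC1.
by exists g.
Qed.

Lemma two_neq0 : (2 : F) != 0.
Proof.
apply/negP => /eqP h2; have [g hg] := prim_root_finField.
have hm : (-1 : F) = 1 by apply/eqP; rewrite eq_sym -subr_eq0 opprK; apply/eqP.
have gh : g ^+ h = 1.
  have : (g ^+ h) ^+ 2 == 1 by rewrite -exprM -card_half (prim_expr_order hg).
  by rewrite sqrf_eq1 hm orbb => /eqP.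
have := prim_order_gt0 hg; move/eqP: gh.
rewrite -(prim_order_dvd hg) => /dvdn_leq; rewrite {-2}card_half; lia.
Qed.

(** Euler's criterion. The multiplicative group is cyclic of even order, with
    generator g, and its squares are the even powers of g. *)
Lemma qchar_exp (x : F) : (qchar x)%:~R = x ^+ h.
Proof.
have [g hg] := prim_root_finField.
have h0 : (0 < h)%N by have := prim_order_gt0 hg; rewrite {1}card_half; lia.
rewrite /qchar; case: eqVneq => [->|x0]; first by rewrite expr0n eqn0Ngt h0.
case: existsP => [[y /eqP xy]|nsq].
  rewrite -xy -exprM mulnC -card_half expf_card1 //.
  by apply: contra_neq x0 => y0; rewrite -xy y0 expr0n.
have : (x ^+ h) ^+ 2 == 1 by rewrite -exprM -card_half expf_card1.
rewrite sqrf_eq1 => /orP[] /eqP xh; last by rewrite xh rmorphN1.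
have [i xi] := prim_rootP hg (expf_card1 x0).
case: nsq; exists (g ^+ (i./2)); rewrite -exprM xi; apply/eqP; congr (_ ^+ _).
move/eqP: xh; rewrite xi -exprM -(prim_order_dvd hg) {1}card_half mulnC.
by rewrite dvdn_pmul2r // dvdn2 => /even_halfK; rewrite -muln2.
Qed.

Lemma int_sign_inj (a b : int) : (a \in [:: 0; 1; -1]) -> (b \in [:: 0; 1; -1]) ->
  a%:~R = b%:~R :> F -> a = b.
Proof.
have h2 := two_neq0; have h1 := oner_neq0 F.
have hm : (1 : F) != -1.
  by rewrite -subr_eq0 opprK.
have hm0 : (-1 : F) != 0 by rewrite oppr_eq0.
rewrite !inE => /or3P[] /eqP -> /or3P[] /eqP -> //; rewrite ?rmorphN1 ?rmorph1 ?rmorph0 => /eqP;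
  rewrite 1?eq_sym ?(negbTE h1) ?(negbTE hm) ?(negbTE hm0) // eq_sym ?(negbTE h1) ?(negbTE hm) ?(negbTE hm0) //.
Qed.

Lemma qchar_sign (x : F) : qchar x \in [:: 0; 1; -1].
Proof. by rewrite /qchar; case: ifP => // _; case: ifP. Qed.

Lemma qcharM (x y : F) : qchar (x * y) = qchar x * qchar y.
Proof.
apply: int_sign_inj; first exact: qchar_sign.
  by rewrite !inE; have := qchar_sign x; have := qchar_sign y; rewrite !inE;
    move=> /or3P[] /eqP -> /or3P[] /eqP ->.
by rewrite rmorphM /= !qchar_exp exprMn.
Qed.

Lemma qchar0 : qchar 0 = 0.
Proof. by rewrite /qchar eqxx. Qed.

Lemma qchar1 : qchar 1 = 1.
Proof.
rewrite /qchar oner_eq0; case: existsP => // -[]; exists 1.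
by rewrite expr1n.
Qed.

Lemma qchar_sqr (x : F) : x != 0 -> qchar x ^+ 2 = 1.
Proof. by move=> x0; rewrite /qchar (negbTE x0); case: ifP. Qed.

Lemma qchar_eq1 (x : F) : qchar x = 1 -> exists y, y ^+ 2 = x.
Proof.
rewrite /qchar; case: eqP => // _; case: existsP => // -[y /eqP hy] _.
by exists y.
Qed.

Lemma qchar_nonres : exists u : F, u != 0 /\ qchar u = -1.
Proof.
have [g hg] := prim_root_finField; exists g.
have q0 := prim_order_gt0 hg.
have g0 : g != 0.
  by apply/eqP => g0; have /eqP := prim_expr_order hg; rewrite g0 expr0n eqn0Ngt q0 eq_sym oner_eq0.
split=> //; have /eqP := qchar_sqr g0; rewrite sqrf_eq1 => /orP[] /eqP // hq.
have : g ^+ h = 1 by rewrite -qchar_exp hq.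
move/eqP; rewrite -(prim_order_dvd hg) => /dvdn_leq; rewrite {-2}card_half.
by move: q0; rewrite {1}card_half; lia.
Qed.

(** Multiplication by a non-residue permutes the field and changes the sign of
    every term. *)
Lemma qchar_sum : \sum_(x : F) qchar x = 0.
Proof.
have [u [u0 hu]] := qchar_nonres.
have E : \sum_(x : F) qchar x = - \sum_(x : F) qchar x.
  rewrite {1}(reindex_inj (mulfI u0)) -sumrN; apply: eq_bigr => x _.
  by rewrite qcharM hu mulN1r.
lia.
Qed.

Lemma qcharN1 : qchar (-1) = (-1) ^+ h.
Proof.
apply: int_sign_inj; first exact: qchar_sign.
  by rewrite -signr_odd; case: odd; rewrite ?expr0 ?expr1.
by rewrite qchar_exp rmorphXn rmorphN1.
Qed.

End QuadraticCharacter.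

(** When n is nonzero in K, the polynomial X^n - 1 is separable, so it has n
    distinct roots. *)
Lemma closed_prim_root (K : closedFieldType) (n : nat) :
  (0 < n)%N -> (n%:R != 0 :> K) -> exists z : K, n.-primitive_root z.
Proof.
move=> n0 nK; have [rs Ers] := closed_field_poly_normal ('X^n - 1 : {poly K}).
have lc : lead_coef ('X^n - 1 : {poly K}) = 1 by apply/eqP; apply: monicXnsubC.
rewrite lc scale1r in Ers.
have urs : uniq rs by rewrite -separable_prod_XsubC -Ers separable_Xn_sub_1.
have /hasP [z _ hz] : has n.-primitive_root rs.
  apply: has_prim_root => //.
    apply/allP => x xrs; rewrite unity_rootE -subr_eq0.
    have : root ('X^n - 1 : {poly K}) x by rewrite Ers root_prod_XsubC.
    by rewrite /root !hornerE.
  by rewrite -ltnS -(size_prod_XsubC rs id) -Ers size_XnsubC.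
by exists z.
Qed.

(** * Quadratic reciprocity by Gauss sums *)

Definition legendre (p n : nat) : int := qchar (n%:R : 'F_p).

Section GaussSum.
Variables (p : nat) (K : fieldType) (z : K).
Hypothesis pp : prime p.
Hypothesis podd : odd p.
Hypothesis hz : p.-primitive_root z.

Let oddF : odd #|'F_p|. Proof. by rewrite card_Fp. Qed.

Definition add_char (a : 'F_p) : K := z ^+ (val a).

Lemma add_charD a b : add_char (a + b) = add_char a * add_char b.
Proof.
have hmod n : z ^+ (n %% (Zp_trunc (pdiv p)).+2) = z ^+ n.
  by rewrite Fp_cast // prim_expr_mod.
by rewrite /add_char -exprD /= hmod.
Qed.

Lemma add_char0 : add_char 0 = 1. Proof. by []. Qed.

Lemma add_char_nat_mul n a : add_char (n%:R * a) = add_char a ^+ n.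
Proof.
elim: n => [|n IH]; first by rewrite mul0r.
by rewrite -natr1 mulrDl mul1r add_charD IH exprSr.
Qed.

Lemma sum_add_char c : \sum_a add_char (a * c) = if c == 0 then p%:R else 0.
Proof.
case: eqVneq => [->|c0].
  under eq_bigr do rewrite mulr0.
  by rewrite add_char0 sumr_const card_Fp.
have c_inj : injective (fun a : 'F_p => a * c) by exact: mulIf.
have -> : \sum_a add_char (a * c) = \sum_a add_char a by rewrite [RHS](reindex_inj c_inj).
have E : \sum_a add_char a = (\sum_a add_char a) * add_char 1.
  rewrite {1}(reindex_inj (addIr 1)) /= mulr_suml.
  by apply: eq_bigr => a _; rewrite add_charD.
apply/eqP; have := subrr (\sum_a add_char a); rewrite {2}E -[X in X - _]mulr1 -mulrBr.
move/eqP; rewrite mulf_eq0 => /orP[//|]; rewrite subr_eq0 eq_sym /add_char /=.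
have -> : (1 %% (Zp_trunc (pdiv p)).+2)%N = 1%N.
  by rewrite Fp_cast // modn_small // prime_gt1.
rewrite -(prim_order_dvd hz) dvdn1 => /eqP p1.
by have := pp; rewrite p1.
Qed.

Definition gauss_sum : K := \sum_a (qchar a)%:~R * add_char a.

(** In the double sum over a and b put b = a c; the inner sum over nonzero a
    of an additive character is p - 1 for c = -1 and - 1 otherwise, and the
    terms - 1 cancel because the quadratic character has sum zero. *)
Lemma gauss_sum_sqr : gauss_sum ^+ 2 = (qchar (-1 : 'F_p))%:~R * p%:R.
Proof.
rewrite expr2 {1}/gauss_sum mulr_suml.
have step (a : 'F_p) : (qchar a)%:~R * add_char a * gauss_sum =
    \sum_(c : 'F_p) (qchar c)%:~R * ((a != 0)%:R * add_char (a * (1 + c))).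
  case: (eqVneq a 0) => [->|a0].
    by rewrite qchar0 rmorph0 !mul0r big1 // => c _; rewrite ?eqxx /= ?mulr0n ?mul0r ?mulr0.
  rewrite /gauss_sum (reindex_inj (mulfI a0)) /= mulr_sumr; apply: eq_bigr => c _.
  rewrite qcharM // rmorphM /= mul1r mulrDr mulr1 add_charD.
  have : (qchar a)%:~R * (qchar a)%:~R = 1 :> K.
    by rewrite -rmorphM -expr2 /= qchar_sqr.
  set x := (qchar a)%:~R => hx.
  transitivity (x * x * ((qchar c)%:~R * (add_char a * add_char (a * c)))); first by ring.
  by rewrite hx mul1r.
under eq_bigr do rewrite step.
rewrite exchange_big /=.
transitivity (\sum_(c : 'F_p) (qchar c)%:~R * ((if c == -1 then p%:R else 0) - 1) : K).
  apply: eq_bigr => c _; rewrite -mulr_sumr; congr (_ * _).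
  have -> : (c == -1) = (1 + c == 0) by rewrite addrC addr_eq0.
  rewrite -sum_add_char [in RHS](bigD1 0) //= mul0r add_char0 addrAC subrr add0r.
  rewrite [in LHS](bigD1 0) //= ?eqxx /= ?mulr0n mul0r add0r; apply: eq_bigr => a a0.
  by rewrite a0 /= mul1r.
under eq_bigr do rewrite mulrBr mulr1.
rewrite sumrB -rmorph_sum /= qchar_sum // subr0 (bigD1 (-1)) //= eqxx.
by rewrite big1 ?addr0 // => c /negbTE ->; rewrite mulr0.
Qed.

(** In characteristic q the q-th power of the sum is the sum of the q-th
    powers, in which a is replaced by q a inside the additive character. *)
Lemma gauss_sum_frobenius q (charq : q \in [pchar K]) : odd q -> coprime p q ->
  gauss_sum ^+ q = (legendre p q)%:~R * gauss_sum.
Proof.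
move=> qodd cpq; rewrite -[LHS](pFrobenius_autE charq) /gauss_sum rmorph_sum /=.
have q0 : (q%:R : 'F_p) != 0 by rewrite -unitfE unitFpE.
rewrite [in RHS](reindex_inj (mulfI q0)) /= mulr_sumr; apply: eq_bigr => a _.
rewrite rmorphM /= pFrobenius_aut_int pFrobenius_autE -add_char_nat_mul qcharM //.
rewrite rmorphM /= mulrA mulrA -rmorphM /legendre -expr2 qchar_sqr //.
by rewrite mul1r.
Qed.

End GaussSum.

Lemma legendre_sign p n : legendre p n \in [:: 0; 1; -1].
Proof. exact: qchar_sign. Qed.

Section Legendre.
Variable p : nat.
Hypothesis pp : prime p.
Hypothesis podd : odd p.
Let oddF : odd #|'F_p|. Proof. by rewrite card_Fp. Qed.

Lemma legendreM m n : legendre p (m * n) = legendre p m * legendre p n.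
Proof. by rewrite /legendre natrM qcharM. Qed.

Lemma legendre1 : legendre p 1 = 1.
Proof. exact: qchar1. Qed.

Lemma legendre_mod n : legendre p (n %% p) = legendre p n.
Proof. by rewrite /legendre Fp_nat_mod. Qed.

Lemma legendre_sqr n : coprime p n -> legendre p n ^+ 2 = 1.
Proof. by move=> cpn; rewrite qchar_sqr // -unitfE unitFpE. Qed.

Lemma legendre_nonres : exists u, coprime p u /\ legendre p u = -1.
Proof.
have [u [u0 hu]] := qchar_nonres oddF; exists (val u).
have e : ((val u)%:R : 'F_p) = u by exact: natr_Zp.
by rewrite /legendre e; split => //; rewrite -unitFpE // e unitfE.
Qed.

Lemma qchar_Fp_N1 : qchar (-1 : 'F_p) = (-1) ^+ (p.-1./2).
Proof. by rewrite qcharN1 // card_Fp. Qed.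

End Legendre.

Lemma pchar_of_morph (q : nat) (K : fieldType) (f : {rmorphism 'F_q -> K}) :
  prime q -> q \in [pchar K].
Proof. by move=> pq; rewrite (fmorph_pchar f) pchar_Fp. Qed.

(** In an algebraic closure of F_q, evaluate g^q for the Gauss sum g in two
    ways: as legendre p q times g by Frobenius, and as (g^2)^((q-1)/2) g with
    the known value of g^2 and the criterion of Euler modulo q. *)
Lemma reciprocity p q : prime p -> prime q -> odd p -> odd q -> p != q ->
  legendre p q = legendre q p * (-1) ^+ (p.-1./2 * q.-1./2).
Proof.
move=> pp pq op oq npq.
have cpq : coprime p q by rewrite prime_coprime // dvdn_prime2.
have [K [f _]] := countable_algebraic_closure 'F_q.
have cq := pchar_of_morph f pq.
have oddF : odd #|'F_q| by rewrite card_Fp.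
have pK : (p%:R : K) != 0.
  by rewrite -(dvdn_pcharf cq) dvdn_prime2 // eq_sym.
have [z hz] := @closed_prim_root K p (prime_gt0 pp) pK.
have g2 := gauss_sum_sqr pp op hz; have gq := gauss_sum_frobenius pp op hz cq oq cpq.
set g := gauss_sum p z in g2 gq.
have e1 : (qchar (-1 : 'F_p))%:~R = (-1) ^+ (p.-1./2) :> K.
  by rewrite qchar_Fp_N1 // rmorphXn rmorphN1.
have g0 : g != 0.
  have : g ^+ 2 != 0 by rewrite g2 e1 mulf_neq0 // signr_eq0.
  by rewrite expf_eq0.
have hq : (q.-1 = q.-1./2 * 2)%N.
  by have := card_half oddF; rewrite card_Fp.
have E : (legendre p q)%:~R = f (legendre q p * (-1) ^+ (p.-1./2 * q.-1./2))%:~R.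
  apply: (mulIf g0); rewrite -gq -{1}(prednK (prime_gt0 pq)) exprSr {1}hq [(_ * 2)%N]mulnC exprM g2 e1.
  congr (_ * _); rewrite rmorph_int exprMn -exprM rmorphM /= rmorphXn rmorphN1.
  rewrite mulrC; congr (_ * _).
  have := qchar_exp oddF (p%:R : 'F_q); rewrite card_Fp // => /(congr1 f).
  by rewrite rmorph_int rmorphXn rmorph_nat => <-.
apply: (int_sign_inj oddF) => //; first exact: legendre_sign.
  rewrite -signr_odd; have := legendre_sign q p; rewrite !inE.
  by case: odd => /or3P[] /eqP ->.
by apply: (fmorph_inj f); rewrite rmorph_int.
Qed.

(** Same idea with t = z + z^-1, z a primitive eighth root of unity: t^2 = 2,
    and t^p = z^p + z^-p is t or - t according to p modulo 8. *)
Lemma legendre2 p : prime p -> odd p ->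
  legendre p 2 = if ((p %% 8 == 1) || (p %% 8 == 7))%N then 1 else -1.
Proof.
move=> pp op.
have [K [f _]] := countable_algebraic_closure 'F_p.
have cp := pchar_of_morph f pp.
have oddF : odd #|'F_p| by rewrite card_Fp.
have K2 : (2%:R : K) != 0.
  rewrite -(dvdn_pcharf cp) dvdn_prime2 //; apply/eqP => p2; by rewrite p2 in op.
have K8 : (8%:R : K) != 0 by rewrite (natrX _ 2 3) expf_neq0.
have [z hz] := @closed_prim_root K 8 isT K8.
have z8 : z ^+ 8 = 1 by apply: prim_expr_order.
have z4 : z ^+ 4 = -1.
  have : (z ^+ 4) ^+ 2 == 1 by rewrite -exprM z8.
  rewrite sqrf_eq1 -(prim_order_dvd hz) /= => /eqP //.
pose t := z + z ^+ 7.
have t2 : t ^+ 2 = 2%:R.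
  have -> : t ^+ 2 = z ^+ 2 * (1 + z ^+ 4 * z ^+ 8) + 2 * z ^+ 8 by rewrite /t; ring.
  by rewrite z4 z8; ring.
have t0 : t != 0.
  have : t ^+ 2 != 0 by rewrite t2.
  by rewrite expf_eq0.
have tp : t ^+ p = z ^+ (p %% 8) + z ^+ (p * 7 %% 8).
  rewrite -(pFrobenius_autE cp) /t rmorphD /= !pFrobenius_autE -exprM.
  by rewrite !(prim_expr_mod hz) [(7 * p)%N]mulnC.
have hp : (p.-1 = p.-1./2 * 2)%N.
  by have := card_half oddF; rewrite card_Fp.
have E : f (legendre p 2)%:~R * t = t ^+ p.
  rewrite -[in RHS](prednK (prime_gt0 pp)) exprSr {1}hp [(_ * 2)%N]mulnC exprM t2.
  congr (_ * _); rewrite /legendre qchar_exp // card_Fp // rmorphXn rmorph_nat //.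
have hp8 : (p * 7 %% 8 = (p %% 8 * 7) %% 8)%N by rewrite modnMml.
have o8 : odd (p %% 8) by rewrite odd_mod.
have z5 : z ^+ 5 = - z by rewrite exprS z4 mulrN1.
have z3 : z ^+ 3 = - z ^+ 7 by rewrite (exprD z 3 4) z4 mulrN1 opprK.
have Es : t ^+ p = (if ((p %% 8 == 1) || (p %% 8 == 7))%N then 1 else -1) * t.
  rewrite tp hp8 /t; have := ltn_pmod p (isT : 0 < 8)%N.
  case: (p %% 8)%N o8 => [|[|[|[|[|[|[|[|]]]]]]]] //= _ _; rewrite /modn /=.
  - by rewrite mul1r.
  - by rewrite z5 z3; ring.
  - by rewrite z5 z3; ring.
  - by ring.
move: E; rewrite Es => /(mulIf t0) E.
apply: (int_sign_inj oddF); first exact: legendre_sign.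
  by case: ifP.
by apply: (fmorph_inj f); rewrite E; case: ifP => _; rewrite ?rmorph1 ?rmorphN1 ?rmorph_int // rmorphN1.
Qed.

(** * Numbers with prescribed Legendre symbols *)

Definition chi4 (n : nat) : int :=
  nth 0 [:: 0; 1; 0; -1] (n %% 4).
Definition chi8 (n : nat) : int :=
  nth 0 [:: 0; 1; 0; -1; 0; -1; 0; 1] (n %% 8).

Lemma chi4M m n : chi4 (m * n) = chi4 m * chi4 n.
Proof.
rewrite /chi4 -modnMm; have := ltn_pmod m (isT : 0 < 4)%N; have := ltn_pmod n (isT : 0 < 4)%N.
by case: (m %% 4)%N => [|[|[|[|]]]] //; case: (n %% 4)%N => [|[|[|[|]]]].
Qed.

Lemma chi8M m n : chi8 (m * n) = chi8 m * chi8 n.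
Proof.
rewrite /chi8 -modnMm; have := ltn_pmod m (isT : 0 < 8)%N; have := ltn_pmod n (isT : 0 < 8)%N.
by case: (m %% 8)%N => [|[|[|[|[|[|[|[|]]]]]]]] //;
   case: (n %% 8)%N => [|[|[|[|[|[|[|[|]]]]]]]].
Qed.

Lemma chi4_mod8 n : chi4 (n %% 8) = chi4 n.
Proof. by rewrite /chi4 modn_dvdm. Qed.

Lemma chi8_mod8 n : chi8 (n %% 8) = chi8 n.
Proof. by rewrite /chi8 modn_mod. Qed.

Lemma chi4_odd n : odd n -> chi4 n ^+ 2 = 1.
Proof.
rewrite -(@odd_mod n 4) // /chi4; have := ltn_pmod n (isT : 0 < 4)%N.
by case: (n %% 4)%N => [|[|[|[|]]]].
Qed.

Lemma chi8_odd n : odd n -> chi8 n ^+ 2 = 1.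
Proof.
rewrite -(@odd_mod n 8) // /chi8; have := ltn_pmod n (isT : 0 < 8)%N.
by case: (n %% 8)%N => [|[|[|[|[|[|[|[|]]]]]]]].
Qed.

Lemma chi4_sign n : odd n -> chi4 n = (-1) ^+ (n.-1./2).
Proof.
move=> on; have [k ->] : exists k, n = k.*2.+1.
  by exists n./2; rewrite -[LHS]odd_double_half on.
rewrite /= doubleK -signr_odd.
have e : (k.*2.+1 %% 4 = (odd k).*2.+1)%N.
  rewrite -[in LHS](odd_double_half k) doubleD -addSn -!muln2 -mulnA -modnDmr modnMl addn0.
  by case: odd.
by rewrite /chi4 e; case: odd.
Qed.

Lemma legendre2_chi8 p : prime p -> odd p -> legendre p 2 = chi8 p.
Proof.
move=> pp op; rewrite legendre2 // /chi8.
have := op; rewrite -(@odd_mod p 8) //; have := ltn_pmod p (isT : 0 < 8)%N.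
by case: (p %% 8)%N => [|[|[|[|[|[|[|[|]]]]]]]].
Qed.

Lemma qchar_Fp_N1_chi4 p : prime p -> odd p -> qchar (-1 : 'F_p) = chi4 p.
Proof. by move=> pp op; rewrite qchar_Fp_N1 // chi4_sign. Qed.

Lemma sqrt_of_neg r n : prime r -> odd r -> chi4 r * legendre r n = 1 ->
  exists x : nat, (r %| x ^ 2 + n)%N.
Proof.
move=> pr or; rewrite -qchar_Fp_N1_chi4 // /legendre -qcharM ?card_Fp // mulN1r => /qchar_eq1 [y hy].
exists (val y).
have e : ((val y)%:R : 'F_r) = y by exact: natr_Zp.
by rewrite (dvdn_pcharf (pchar_Fp pr)) natrD natrX e hy addNr.
Qed.

Lemma square_free_prod n : (0 < n)%N -> square_free n ->
  n = (\prod_(p <- primes n) p)%N.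
Proof.
move=> n0 sn; rewrite {1}(prod_prime_decomp n0) prime_decompE big_map /=.
rewrite big_seq [RHS]big_seq; apply: eq_bigr => p.
rewrite mem_primes => /and3P[pp _ pn].
have : (logn p n < 2)%N by rewrite ltnNge -pfactor_dvdn // sn.
have : (0 < logn p n)%N by rewrite logn_gt0 mem_primes pp n0.
by case: (logn p n) => [|[|]].
Qed.

Lemma multiplicative_prod (f : nat -> int) (s : seq nat) : f 1%N = 1 ->
  (forall m n, f (m * n)%N = f m * f n) ->
  f (\prod_(p <- s) p)%N = \prod_(p <- s) f p.
Proof.
move=> f1 fM; elim: s => [|p s IH]; first by rewrite !big_nil.
by rewrite !big_cons fM IH.
Qed.

(** Chinese remainder theorem over the prime factors of d. *)
Lemma sqrt_mod_square_free (d a : nat) : (0 < d)%N -> square_free d ->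
  (forall r, prime r -> (r %| d)%N -> exists x, (r %| x ^ 2 + a)%N) ->
  exists x, (d %| x ^ 2 + a)%N.
Proof.
move: d; apply: pfactor_ind => [|p k m pp k0 m0 cpm IH] sd hr.
  by exists 0%N; rewrite dvd1n.
have k1 : k = 1%N.
  case: k k0 sd {hr} => [|[|k]] // _ /(_ p pp).
  by rewrite dvdn_mulr // dvdn_exp2l.
rewrite k1 expn1 in sd hr *.
have [x hx] := hr p pp (dvdn_mulr _ (dvdnn p)).
have [y hy] : exists y, (m %| y ^ 2 + a)%N.
  apply: IH => [r pr|r pr rm].
    by apply: contra (sd r pr) => h; apply: dvdn_mull.
  by apply: hr => //; apply: dvdn_mull.
exists (chinese p m x y).
rewrite Gauss_dvd //; apply/andP; split.
  by rewrite /dvdn -modnDml -modnXm chinese_modl // modnXm modnDml.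
by rewrite /dvdn -modnDml -modnXm chinese_modr // modnXm modnDml.
Qed.

(** Multiply the reciprocity laws of r with the primes of n. The signs combine
    because chi4 is multiplicative. *)
Lemma jacobi_reciprocity n r : odd n -> square_free n -> prime r -> odd r ->
  coprime r n ->
  legendre r n = (\prod_(p <- primes n) legendre p r) * chi4 n ^+ (r.-1./2).
Proof.
move=> on sn pr or crn; have n0 : (0 < n)%N by apply: odd_gt0.
rewrite {1 3}(square_free_prod n0 sn) !multiplicative_prod //; last 3 first.
- exact: chi4M.
- exact: legendre1.
- by move=> x y; apply: legendreM; rewrite // card_Fp.
rewrite -prodrXl -big_split /= big_seq [RHS]big_seq; apply: eq_bigr => p.
rewrite mem_primes => /and3P[pp _ pn].
have op : odd p by apply: dvdn_odd pn on.
rewrite reciprocity //; last first.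
  by apply: contraTneq crn => ->; rewrite prime_coprime // pn.
by rewrite chi4_sign // -exprM mulnC.
Qed.

Lemma coprime8n x : coprime 8 x = odd x.
Proof. by rewrite -[8%N]/(2 ^ 3)%N coprime_pexpl // coprime2n. Qed.

(** A list of natural numbers indexes all characters at once: a prime k stands
    for the Legendre symbol modulo k, and 0, which is not prime, for a
    character c modulo 8. *)
Definition index_char (c : nat -> int) (k : nat) : nat -> int :=
  if k == 0%N then c else legendre k.

(** The characters have period 8 m. They are independent: by the Chinese
    remainder theorem a number can be made a non-residue for one of them and 1
    modulo the moduli of the others. *)
Lemma prescribed_residues (m : nat) (c : nat -> int) (s : seq nat) (eps : nat -> int) :
  odd m -> square_free m -> s = primes m \/ s = 0%N :: primes m -> s != [::] ->
  c 1%N = 1 -> (forall x y, c (x * y)%N = c x * c y) ->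
  (forall x, c (x %% 8)%N = c x) -> (forall x, odd x -> c x ^+ 2 = 1) ->
  (exists2 u, odd u & c u = -1) ->
  (forall k, k \in s -> eps k ^+ 2 = 1) -> \prod_(k <- s) eps k = 1 ->
  exists d, [/\ (0 < d)%N, odd d, coprime m d, square_free d &
    (forall k, k \in s -> index_char c k d = eps k) /\
    (forall r, prime r -> (r %| d)%N -> \prod_(k <- s) index_char c k r = 1)].
Proof.
move=> om sm hs s0 c1 cM c8 cU [u8 ou8 cu8] eps2 eps1.
have m0 : (0 < m)%N by apply: odd_gt0.
have us : uniq s.
  by case: hs => ->; rewrite /= primes_uniq ?andbT // mem_primes.
have sk k : k \in s -> k = 0%N \/ [/\ prime k, odd k & (k %| m)%N].
  have hp : k \in primes m -> [/\ prime k, odd k & (k %| m)%N].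
    by rewrite mem_primes => /and3P[pk _ km]; split => //; apply: dvdn_odd km om.
  case: hs => ->; first by move/hp; right.
  by rewrite inE => /predU1P [->|/hp]; [left|right].
have c8m : coprime 8 m by rewrite coprime8n.
pose N := (8 * m)%N.
have N0 : (0 < N)%N by rewrite muln_gt0.
have coN x : coprime N x = odd x && coprime m x.
  by rewrite coprimeMl coprime8n.
have chM k x y : k \in s -> index_char c k (x * y) = index_char c k x * index_char c k y.
  rewrite /index_char => /sk [->|[pk ok _]] //.
  by case: eqP => // _; rewrite legendreM.
have ch1 k : k \in s -> index_char c k 1 = 1.
  rewrite /index_char => /sk [->|[pk ok _]] //.
  by case: eqP => // _; rewrite legendre1.
have chmod k x y : k \in s -> x = y %[mod (if k == 0%N then 8 else k)] ->
    index_char c k x = index_char c k y.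
  rewrite /index_char => /sk [->|[pk ok _]] /=.
    by move=> e; rewrite -c8 e c8.
  case: eqP => [k0|_]; first by rewrite k0 in pk.
  by move=> e; rewrite -legendre_mod // e legendre_mod.
have kN k : k \in s -> ((if k == 0%N then 8 else k) %| N)%N.
  case/sk => [->|[pk ok km]] /=; first by rewrite dvdn_mulr.
  by case: eqP => _; [rewrite dvdn_mulr|apply: dvdn_mull].
have chN k x : k \in s -> index_char c k (x + N) = index_char c k x.
  move=> ks; apply: chmod => //.
  by have /dvdnP [q ->] := kN k ks; rewrite addnC modnMDl.
have chU k x : k \in s -> coprime N x -> index_char c k x ^+ 2 = 1.
  rewrite coN /index_char => /sk [->|[pk ok km]] /andP[ox cx] /=; first exact: cU.
  case: eqP => [k0|_]; first by rewrite k0 in pk.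
  by apply: legendre_sqr; rewrite ?(coprime_dvdl km).
have chI k : k \in s -> exists u, [/\ coprime N u, index_char c k u = -1 &
    forall l, l \in s -> l != k -> index_char c l u = 1].
  move=> ks; case: (sk k ks) => [k0|[pk ok km]].
    exists (chinese 8 m u8 1); split.
    - rewrite coN; apply/andP; split.
        by rewrite -(@odd_mod _ 8) // chinese_modl // odd_mod.
      by rewrite coprime_sym -coprime_modl chinese_modr // coprime_modl coprime1n.
    - by rewrite k0 /index_char /= -c8 chinese_modl // c8.
    move=> l ls lk; rewrite -(ch1 l ls); apply: chmod => //.
    case: (sk l ls) => [l0|[pl ol lm]]; first by rewrite l0 k0 eqxx in lk.
    case: eqP => [l0|_]; first by rewrite l0 in pl.
    by rewrite -(modn_dvdm _ lm) chinese_modr // modn_dvdm.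
  have knz : k == 0%N = false by case: eqP pk => [->|].
  have [u [cu hu]] := legendre_nonres pk ok.
  have [m' em] : exists m', m = (m' * k)%N by apply/dvdnP.
  have ckm : coprime k m'.
    rewrite prime_coprime //; apply: contra (sm k pk) => h.
    by rewrite em expnS expn1 dvdn_mul.
  have ck8 : coprime k (8 * m').
    by rewrite coprimeMr ckm andbT coprime_sym coprime8n.
  have om' : odd m' by move: om; rewrite em oddM => /andP[].
  pose v := chinese k (8 * m') u 1.
  have v8 : v = 1 %[mod 8].
    by rewrite -(@modn_dvdm (8 * m')) ?dvdn_mulr // chinese_modr // modn_dvdm ?dvdn_mulr.
  have vm l : (l %| m')%N -> v = 1 %[mod l].
    move=> lm; rewrite -(@modn_dvdm (8 * m')) ?dvdn_mull // chinese_modr //.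
    by rewrite modn_dvdm ?dvdn_mull.
  exists v; split.
  - rewrite coN; apply/andP; split; first by rewrite -(@odd_mod _ 8) // v8.
    rewrite em coprimeMl; apply/andP; split.
      by rewrite coprime_sym -coprime_modl vm // coprime_modl coprime1n.
    by rewrite coprime_sym -coprime_modl chinese_modl // coprime_modl coprime_sym.
  - have <- : index_char c k u = -1 by rewrite /index_char knz.
    by apply: chmod => //; rewrite knz chinese_modl.
  move=> l ls lk; rewrite -(ch1 l ls); apply: chmod => //.
  case: (sk l ls) => [-> //|[pl ol lm]].
  case: eqP => [l0|_]; first by rewrite l0 in pl.
  apply: vm; move: lm; rewrite em Gauss_dvdl //.
  by rewrite prime_coprime // dvdn_prime2.
have inth (i : 'I_(size s)) : nth 0%N s i \in s by rewrite mem_nth.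
pose lam (i : 'I_(size s)) n : R := (index_char c (nth 0%N s i) n)%:~R.
have prodE (f : nat -> int) : \prod_(i < size s) (f (nth 0%N s i))%:~R =
   (\prod_(k <- s) f k)%:~R :> R.
  by rewrite rmorph_prod /= [RHS](big_nth 0%N) big_mkord.
have [||||||||d [d0 cd sd hd hr]] := @prescribed_characters _ N lam N0 _ _ _ _ _
    (fun i => (eps (nth 0%N s i))%:~R).
- by move=> i x y; rewrite /lam chM // rmorphM.
- by move=> i; rewrite /lam ch1.
- by move=> i x; rewrite /lam chN.
- by move=> i x cx; rewrite /lam -rmorphXn /= chU.
- move=> i; have [u [cu hu hl]] := chI _ (inth i); exists u; split => //.
    by rewrite /lam hu rmorphN1.
  by move=> j ji; rewrite /lam hl // nth_uniq.
- by move=> i; rewrite -rmorphXn /= eps2.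
- by rewrite prodE eps1.
- by rewrite card_ord; case: (s) s0.
move: (cd); rewrite coN => /andP[od cmd].
exists d; split => //; split.
  move=> k ks; have ki : (index k s < size s)%N by rewrite index_mem.
  have := hd (Ordinal ki); rewrite /lam /= nth_index // => /eqP.
  by rewrite eqr_int => /eqP.
move=> r pr rd; have := hr r pr rd; rewrite /lam (prodE (fun k => index_char c k r)).
by move/eqP; rewrite -[1](rmorph1 (intr : {rmorphism int -> R})) eqr_int => /eqP.
Qed.

(** * Sums of three squares *)

(** The second condition says that - al has a square root e modulo n; e is
    prime to n because al is. *)
Lemma sum3sq_of_residues (n al : nat) : (0 < n)%N -> square_free n ->
  (0 < al)%N -> coprime al n -> (exists x, (al %| x ^ 2 + n)%N) ->
  (forall r, prime r -> (r %| n)%N -> exists x, (r %| x ^ 2 + al)%N) ->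
  sum3sq n%:Z.
Proof.
move=> n0 sn al0 can [be hbe] hr.
have [e he] := sqrt_mod_square_free n0 sn hr.
have sqrZ (a b : nat) : a%:Z ^+ 2 + b%:Z = (a ^ 2 + b)%N%:Z.
  by rewrite PoszD expnS expn1 PoszM expr2.
apply: (@sum3sq_of_binary _ al%:Z be%:Z e%:Z); rewrite ?ltz_nat //.
  by rewrite addrC sqrZ dvdzE.
rewrite coprimezE /= coprime_sym; apply: contraLR can.
move=> h; have h1 : (1 < gcdn n e)%N.
  by rewrite ltn_neqAle gcdn_gt0 n0 andbT eq_sym.
have pr := pdiv_prime h1; set r := pdiv _ in pr.
have /(dvdn_trans (pdiv_dvd _)) rn := dvdn_gcdl n e.
have /(dvdn_trans (pdiv_dvd _)) re := dvdn_gcdr n e.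
have ral : (r %| al)%N.
  have := dvdn_trans rn he; rewrite dvdn_addr //.
  by rewrite expnS dvdn_mulr.
apply/negP => /eqP c; have : (r %| gcdn al n)%N by rewrite dvdn_gcd ral.
by rewrite c dvdn1 => /eqP r1; rewrite r1 in pr.
Qed.

Lemma sqrt_neg_mod d n : (0 < d)%N -> square_free d -> odd d ->
  (forall r, prime r -> odd r -> (r %| d)%N -> chi4 r * legendre r n = 1) ->
  exists x, (d %| x ^ 2 + n)%N.
Proof.
move=> d0 sd od h; apply: sqrt_mod_square_free => // r pr rd.
have or := dvdn_odd rd od.
by apply: sqrt_of_neg => //; apply: h.
Qed.

Lemma prod_chi4 n : odd n -> square_free n -> \prod_(p <- primes n) chi4 p = chi4 n.
Proof.
move=> on sn; rewrite {2}(square_free_prod (odd_gt0 on) sn) multiplicative_prod //.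
exact: chi4M.
Qed.

Lemma prod_chi8 n : odd n -> square_free n -> \prod_(p <- primes n) chi8 p = chi8 n.
Proof.
move=> on sn; rewrite {2}(square_free_prod (odd_gt0 on) sn) multiplicative_prod //.
exact: chi8M.
Qed.

Lemma prod_index_primes c n r :
  \prod_(k <- primes n) index_char c k r = \prod_(k <- primes n) legendre k r.
Proof.
rewrite big_seq [RHS]big_seq; apply: eq_bigr => k.
by rewrite mem_primes /index_char => /andP[pk _]; case: eqP pk => // ->.
Qed.

Lemma coprime_dvd_sym r d n : (r %| d)%N -> coprime n d -> coprime r n.
Proof. by move=> rd cnd; rewrite coprime_sym (coprime_dvdr rd). Qed.

Lemma primes_pos n k : k \in primes n -> [/\ prime k, (k %| n)%N & k == 0%N = false].
Proof.
by rewrite mem_primes => /and3P[pk _ kn]; split => //; case: eqP pk => // ->.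
Qed.

(** Ask for d = 1 modulo 4 with legendre k d = chi4 k, that is - d a square
    modulo k, at the primes k of n. The product of the prescribed values is
    chi4 n = 1. For a prime r of d, reciprocity gives legendre r n as the
    product of the legendre k r, hence chi4 r * legendre r n = 1. *)
Lemma three_squares_1mod4 n : square_free n -> (n %% 4 = 1)%N -> sum3sq n%:Z.
Proof.
move=> sn n4; have on : odd n by rewrite -(@odd_mod n 4) // n4.
have n0 := odd_gt0 on; have c4n : chi4 n = 1 by rewrite /chi4 n4.
have c41 : chi4 1 = 1 by [].
pose eps k : int := if k == 0%N then 1 else chi4 k.
have [||||d [d0 od cnd sd [hd hr]]] := @prescribed_residues n chi4 (0%N :: primes n) eps
  on sn (or_intror erefl) isT c41 chi4M _ chi4_odd.
- by move=> x; rewrite /chi4 modn_dvdm.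
- by exists 3%N.
- move=> k; rewrite inE /eps => /predU1P [->|/primes_pos [pk kn ->]] //.
  by apply: chi4_odd; apply: dvdn_odd kn on.
- rewrite big_cons /eps /= mul1r -[RHS]c4n -prod_chi4 // big_seq [RHS]big_seq.
  by apply: eq_bigr => k /primes_pos [_ _ ->].
have hsq : exists x, (d %| x ^ 2 + n)%N.
  apply: sqrt_neg_mod => // r pr or rd.
  rewrite (jacobi_reciprocity on sn pr or (coprime_dvd_sym rd cnd)).
  by rewrite c4n expr1n mulr1; have := hr r pr rd; rewrite big_cons prod_index_primes.
apply: (@sum3sq_of_residues n d) => //; first by rewrite coprime_sym.
move=> r pr rn; apply: sqrt_of_neg => //; first exact: dvdn_odd rn on.
have rs : r \in primes n by rewrite mem_primes pr n0.
have [_ _ r0] := primes_pos rs.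
have := hd r; rewrite inE rs orbT /index_char /eps r0 => /(_ isT) ->.
by rewrite -expr2 chi4_odd // (dvdn_odd rn).
Qed.

(** Use 2 d, with - 2 d a square modulo the primes of n. The prescribed values
    legendre k d = chi8 k * chi4 k have product chi8 n * chi4 n = 1. Here chi4
    n = -1, and the sign in the reciprocity law cancels chi4 r, so no
    condition on d modulo 8 is imposed. *)
Lemma three_squares_3mod8 n : square_free n -> (n %% 8 = 3)%N -> sum3sq n%:Z.
Proof.
move=> sn n8; have on : odd n by rewrite -(@odd_mod n 8) // n8.
have n0 := odd_gt0 on; have c8n : chi8 n = -1 by rewrite /chi8 n8.
have c4n : chi4 n = -1 by rewrite -chi4_mod8 n8.
have c41 : chi4 1 = 1 by [].
pose eps k := chi8 k * chi4 k.
have odd_pr k : k \in primes n -> odd k.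
  by case/primes_pos => _ kn _; apply: dvdn_odd kn on.
have sne : primes n != [::].
  have n1 : (1 < n)%N by move: n8; case: (n) => [|[|]].
  have : pdiv n \in primes n by rewrite mem_primes pdiv_prime // n0 pdiv_dvd.
  by case: (primes n).
have [||||d [d0 od cnd sd [hd hr]]] := @prescribed_residues n chi4 (primes n) eps
  on sn (or_introl erefl) sne c41 chi4M _ chi4_odd.
- by move=> x; rewrite /chi4 modn_dvdm.
- by exists 3%N.
- by move=> k /odd_pr ok; rewrite exprMn chi4_odd // chi8_odd.
- by rewrite big_split /= prod_chi4 // prod_chi8 // c8n c4n.
have hsq : exists x, (d %| x ^ 2 + n)%N.
  apply: sqrt_neg_mod => // r pr or rd.
  rewrite (jacobi_reciprocity on sn pr or (coprime_dvd_sym rd cnd)).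
  have := hr r pr rd; rewrite prod_index_primes => ->.
  by rewrite mul1r c4n -chi4_sign // -expr2 chi4_odd.
have hsq2 : exists x, (2 * d %| x ^ 2 + n)%N.
  have [x hx] := hsq.
  (* A square root modulo d can be made odd by adding d, and then it is a
     square root modulo 2 d. *)
  have [y [oy hy]] : exists y, odd y /\ (d %| y ^ 2 + n)%N.
    case: (boolP (odd x)) => ox; first by exists x.
    exists (x + d)%N; rewrite oddD (negbTE ox) od; split => //.
    have -> : ((x + d) ^ 2 + n = (x ^ 2 + n) + d * (2 * x + d))%N.
      by rewrite sqrnD -[(d ^ 2)%N]mulnn; lia.
    by rewrite dvdn_add // dvdn_mulr.
  exists y; rewrite Gauss_dvd ?coprime2n // hy andbT dvdn2 oddD oddX oy on //.
apply: (@sum3sq_of_residues n (2 * d)) => //; first by rewrite muln_gt0.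
  by rewrite coprimeMl coprime2n on coprime_sym.
move=> r pr rn; have or := dvdn_odd rn on; apply: sqrt_of_neg => //.
have rs : r \in primes n by rewrite mem_primes pr n0.
have [_ _ r0] := primes_pos rs.
have := hd r rs; rewrite /index_char /eps r0 legendreM // => ->.
rewrite legendre2_chi8 //.
transitivity (chi4 r ^+ 2 * chi8 r ^+ 2); first by ring.
by rewrite chi4_odd // chi8_odd.
Qed.

(** For n = 2 m, legendre r 2 = chi8 r enters the condition chi4 r * legendre
    r n = 1 at the primes r of d, and the reciprocity law with m contributes
    chi4 r when chi4 m = -1. The character c modulo 8 is what remains besides
    the symbols modulo the primes of m. *)
Lemma three_squares_2mod4 n : square_free n -> (n %% 4 = 2)%N -> sum3sq n%:Z.
Proof.
move=> sn n4; have [m en om] : exists2 m, n = (2 * m)%N & odd m.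
  exists (n %/ 2)%N; lia.
have m0 := odd_gt0 om; have n0 : (0 < n)%N by rewrite en muln_gt0.
have sm : square_free m.
  by move=> p pp; apply: contra (sn p pp) => h; rewrite en dvdn_mull.
pose b := chi4 m == 1.
have c4m : chi4 m = if b then 1 else -1.
  rewrite /b; have /eqP := chi4_odd om; rewrite sqrf_eq1.
  by move=> /orP[] /eqP ->.
pose c x := if b then chi4 x * chi8 x else chi8 x.
have cM x y : c (x * y)%N = c x * c y.
  by rewrite /c; case: (b); rewrite ?chi4M chi8M //; ring.
have c1 : c 1%N = 1 by rewrite /c; case: (b).
have cmod x : c (x %% 8)%N = c x.
  by rewrite /c; case: (b); rewrite ?chi4_mod8 chi8_mod8.
have cU x : odd x -> c x ^+ 2 = 1.
  by move=> ox; rewrite /c; case: (b); rewrite ?exprMn ?chi4_odd // chi8_odd.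
pose eps k : int := if k == 0%N then (if b then 1 else -1) else chi4 k.
have [|||d [d0 od cmd sd [hd hr]]] := @prescribed_residues m c (0%N :: primes m) eps
  om sm (or_intror erefl) isT c1 cM cmod cU.
- by exists (if b then 5 else 3)%N; rewrite /c; case: (b).
- move=> k; rewrite inE /eps => /predU1P [->|/primes_pos [pk kn ->]] //=.
    by case: (b).
  by apply: chi4_odd; apply: dvdn_odd kn om.
- rewrite big_cons /eps /=.
  have -> : \prod_(k <- primes m) (if k == 0%N then if b then 1 else -1 else chi4 k) = chi4 m.
    rewrite -prod_chi4 // big_seq [RHS]big_seq.
    by apply: eq_bigr => k /primes_pos [_ _ ->].
  by rewrite c4m; case: (b).
have hsq : exists x, (d %| x ^ 2 + n)%N.
  apply: sqrt_neg_mod => // r pr or rd.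
  rewrite en legendreM // legendre2_chi8 // (jacobi_reciprocity om sm pr or (coprime_dvd_sym rd cmd)).
  have := hr r pr rd; rewrite big_cons prod_index_primes /index_char /= /c c4m.
  case: (b); first by rewrite expr1n mulr1 !mulrA.
  rewrite -chi4_sign // => h.
  transitivity (chi4 r ^+ 2 * (chi8 r * \prod_(p <- primes m) legendre p r)); first by ring.
  by rewrite h chi4_odd.
apply: (@sum3sq_of_residues n d) => //.
  by rewrite en coprimeMr coprime_sym coprime2n od coprime_sym.
move=> r pr rn; case: (eqVneq r 2%N) => [->|r2].
  by exists 1%N; rewrite dvdn2 oddD od.
have rm : (r %| m)%N.
  by move: rn; rewrite en Gauss_dvdr // prime_coprime // dvdn_prime2.
apply: sqrt_of_neg => //; first exact: dvdn_odd rm om.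
have rs : r \in primes m by rewrite mem_primes pr m0.
have [_ _ r0] := primes_pos rs.
have := hd r; rewrite inE rs orbT /index_char /eps r0 => /(_ isT) ->.
by rewrite -expr2 chi4_odd // (dvdn_odd rm).
Qed.

Lemma sum3sqZ (k n : int) : sum3sq n -> sum3sq (k ^+ 2 * n).
Proof.
by move=> [x [y [z ->]]]; exists (k * x), (k * y), (k * z); ring.
Qed.

(** The residues of a sum of three squares that is not divisible by 4. *)
Definition ternary_class (n : nat) : bool :=
  [|| n %% 4 == 1, n %% 4 == 2 | n %% 8 == 3]%N.

Lemma square_free_part n : (0 < n)%N -> exists k m, n = (k ^ 2 * m)%N /\ square_free m.
Proof.
have [l] := ubnP n; elim: l n => // l IH n hn n0.
case: (boolP (has (fun p => (p ^ 2 %| n)%N) (primes n))).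
  move=> /hasP [p]; rewrite mem_primes => /and3P[pp _ _] /dvdnP [q eq].
  have p2 : (1 < p ^ 2)%N by rewrite -(exp1n 2) ltn_exp2r // prime_gt1.
  have q0 : (0 < q)%N by move: n0; rewrite eq muln_gt0 => /andP[].
  have [|k [m [em sm]]] := IH q _ q0.
    by apply: (@leq_trans n) => //; rewrite eq ltn_Pmulr.
  by exists (p * k)%N, m; split => //; rewrite eq em expnMn; lia.
move=> /hasPn h; exists 1%N, n; split; first by rewrite exp1n mul1n.
move=> p pp; apply/negP => hp; have := h p; rewrite mem_primes pp n0 /= hp.
by move=> /(_ (dvdn_trans (dvdn_mulr p (dvdnn p)) hp)).
Qed.

(** When n is not divisible by 4, the largest k with k^2 dividing n is odd, so
    k^2 is 1 modulo 8 and dividing by it does not change the class. *)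
Lemma three_squares n : ternary_class n -> sum3sq n%:Z.
Proof.
move=> hn; have n0 : (0 < n)%N by case: n hn.
have [k [m [en sm]]] := square_free_part n0.
have hm : ternary_class m.
  move: hn; rewrite /ternary_class en => h.
  have k8 : exists r, [/\ (k ^ 2 %% 8 = r)%N & r \in [:: 0; 1; 4]%N].
    exists (k ^ 2 %% 8)%N; split => //; rewrite -modnXm.
    have := ltn_pmod k (isT : 0 < 8)%N.
    by case: (k %% 8)%N => [|[|[|[|[|[|[|[|]]]]]]]].
  move: k8 => [r [hk hr]].
  have e8 : ((k ^ 2 * m) %% 8 = (r * (m %% 8)) %% 8)%N by rewrite -hk modnMmr modnMml.
  have e4 : ((k ^ 2 * m) %% 4 = (r * (m %% 8)) %% 4)%N.
    by rewrite -(@modn_dvdm 8) // e8 modn_dvdm.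
  have m4 : (m %% 4 = (m %% 8) %% 4)%N by rewrite modn_dvdm.
  move: h; rewrite e8 e4 m4; have := ltn_pmod m (isT : 0 < 8)%N.
  move: hr; rewrite !inE => /or3P[] /eqP ->;
  by case: (m %% 8)%N => [|[|[|[|[|[|[|[|]]]]]]]].
rewrite en PoszM expnS expn1 PoszM -expr2; apply: sum3sqZ.
move: hm => /or3P[] /eqP.
- exact: three_squares_1mod4.
- exact: three_squares_2mod4.
- exact: three_squares_3mod8.
Qed.

(** * Rational points in the nonnegative octant *)

(** Newton's iteration h -> (h^2 + a) / (2 h) stays above the root and divides
    the error h^2 - a by at least 4. *)
Lemma rat_sqrt_above (a M : rat) (n : nat) : 0 < M -> 0 <= a -> a <= M ^+ 2 ->
  exists h, [/\ 0 < h, h <= M, a <= h ^+ 2 & h ^+ 2 - a <= (M ^+ 2 - a) / 4 ^+ n].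
Proof.
move=> M0 a0 aM; elim: n => [|n [h [h0 hM ah hn]]].
  by exists M; split => //; rewrite expr0 divr1.
have h2 : 0 < h ^+ 2 by rewrite exprn_gt0.
pose h' := (h ^+ 2 + a) / (2 * h).
have hne : h != 0 by rewrite gt_eqF.
have e : h' ^+ 2 - a = (h ^+ 2 - a) * ((h ^+ 2 - a) / (4 * h ^+ 2)).
  by rewrite /h'; field.
exists h'; split.
- by rewrite divr_gt0 //; lra.
- by apply: le_trans hM; rewrite ler_pdivrMr; nra.
- by rewrite -subr_ge0 e mulr_ge0 ?divr_ge0 ?subr_ge0 // mulr_ge0 // ltW.
have q4 : (h ^+ 2 - a) / (4 * h ^+ 2) <= 4^-1.
  by rewrite ler_pdivrMr; lra.
have d0 : 0 <= h ^+ 2 - a by rewrite subr_ge0.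
have d1 : 0 <= (h ^+ 2 - a) / (4 * h ^+ 2) by rewrite divr_ge0 // mulr_ge0 // ltW.
rewrite e [4 ^+ n.+1]exprSr [(4 ^+ n * 4)^-1]invfM [leRHS]mulrA; exact: (ler_pM d0 d1 hn q4).
Qed.

Lemma pow4_large (x : rat) : exists n, x <= 4 ^+ n.
Proof.
exists (Num.bound `|x|); apply: (@le_trans _ _ (Num.bound `|x|)%:R).
  by apply: le_trans (ler_norm x) _; apply/ltW; apply: archi_boundP.
rewrite -natrX ler_nat; elim: (Num.bound _) => // n IH.
by rewrite expnS; lia.
Qed.

(** Rational rotations of the conic move any rational point close to the axis.
    If h were the exact square root of rho / D, the rotation below would carry
    (al, be) to (h, 0); a rational h slightly larger makes the second
    coordinate small instead. *)
Lemma conic_point (D al be M : rat) : 0 < D -> 0 < M ->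
  D * al ^+ 2 + be ^+ 2 < D * M ^+ 2 ->
  exists al' be', D * al' ^+ 2 + be' ^+ 2 = D * al ^+ 2 + be ^+ 2 /\
                  `|al'| + `|be'| <= M.
Proof.
move=> D0 M0 hM; case: (eqVneq be 0) => [b0|b0].
  exists al, be; split => //; rewrite b0 normr0 addr0.
  rewrite -(@ler_sqr _ `|al| M) ?nnegrE ?normr_ge0 ?(ltW M0) // real_normK ?num_real //.
  by rewrite -(ler_pM2l D0); move: hM; rewrite b0 expr0n addr0 => /ltW.
set rho := D * al ^+ 2 + be ^+ 2 in hM *.
have be2 : 0 < be ^+ 2 by rewrite exprn_even_gt0.
have rho0 : 0 < rho by rewrite /rho ltr_wpDl // mulr_ge0 ?sqr_ge0 // ltW.
pose a := rho / D.
have Da : D * a = rho by rewrite /a; field; rewrite gt_eqF.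
have a0 : 0 < a by rewrite divr_gt0.
have aM : a < M ^+ 2 by rewrite -(ltr_pM2l D0) Da.
(* One step of Newton from M gives a bound strictly below M and leaves the
   room M - M1 for the second coordinate. *)
pose M1 := (M ^+ 2 + a) / (2 * M).
have M10 : 0 < M1 by rewrite divr_gt0 //; nra.
have M1M : M1 < M by rewrite ltr_pdivrMr; nra.
have aM1 : a <= M1 ^+ 2.
  rewrite -subr_ge0 (_ : _ - _ = ((M ^+ 2 - a) / (2 * M)) ^+ 2) ?sqr_ge0 //.
  by rewrite /M1; field; rewrite gt_eqF.
have nb : 0 < `|be| by rewrite normr_gt0.
have [n hn] := pow4_large (D * (M1 ^+ 2 - a) / ((M - M1) * `|be|)).
have [h [h0 hM1 ah hh]] := rat_sqrt_above n M10 (ltW a0) aM1.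
have hDh : D * h ^+ 2 - rho <= (M - M1) * `|be|.
  rewrite -Da -mulrBr; apply: (@le_trans _ _ (D * ((M1 ^+ 2 - a) / 4 ^+ n))).
    by rewrite ler_pM2l.
  have p4 : 0 < 4 ^+ n :> rat by rewrite exprn_gt0.
  rewrite mulrA ler_pdivrMr // [leRHS]mulrC -ler_pdivrMr ?mulr_gt0 ?subr_gt0 //.
have Dh : rho <= D * h ^+ 2 by rewrite -Da ler_pM2l.
(* Rational parameter of the rotation; 1 + D r^2 is its norm. *)
pose r := (h - al) / be.
have u0 : 0 < 1 + D * r ^+ 2 by rewrite ltr_pwDl // mulr_ge0 ?sqr_ge0 // ltW.
have une : 1 + D * r ^+ 2 != 0 by rewrite gt_eqF.
pose be' := (be * (1 - D * r ^+ 2) - 2 * D * r * al) / (1 + D * r ^+ 2).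
pose al' := (al * (1 - D * r ^+ 2) + 2 * r * be) / (1 + D * r ^+ 2).
have on : D * al' ^+ 2 + be' ^+ 2 = rho.
  by rewrite /al' /be' /rho; field.
exists al', be'; split => //.
have hal : `|al'| <= h.
  rewrite -(@ler_sqr _ `|al'| h) ?nnegrE ?normr_ge0 ?(ltW h0) // real_normK ?num_real //.
  by rewrite -(ler_pM2l D0); apply: le_trans Dh; rewrite -on lerDl sqr_ge0.
have hbe : `|be'| <= M - M1.
  have -> : be' = (rho - D * h ^+ 2) / be / (1 + D * r ^+ 2).
    rewrite /be'; congr (_ / _); rewrite /rho /r; field.
    by [].
  rewrite normrM normfV (gtr0_norm u0) ler_pdivrMr //.
  rewrite normrM normfV ler_pdivrMr // distrC ger0_norm ?subr_ge0 //.
  apply: le_trans hDh _; rewrite -mulrA ler_pM2l ?subr_gt0 //.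
  by rewrite ler_peMl ?normr_ge0 // lerDl mulr_ge0 ?sqr_ge0 // ltW.
by apply: le_trans (lerD hal hbe) _; lra.
Qed.

(** With D = 2 k^2 + 1, the circle is parametrized by the conic D a^2 + b^2 =
    rho as x = s / D - 2 k a, z = M + a + b, w = M + a - b. The condition n <
    s^2 says rho < D M^2, so the point with b = 0 and a = - sqrt (rho / D)
    satisfies x, z, w > 0, and the nearby rational point satisfies the same
    inequalities weakly. *)
Lemma nonneg_point_on_circle (k s n x0 z0 w0 : rat) : 0 < k -> 0 < s ->
  x0 + k * z0 + k * w0 = s -> x0 ^+ 2 + z0 ^+ 2 + w0 ^+ 2 = n -> n < s ^+ 2 ->
  exists x z w, [/\ 0 <= x, 0 <= z, 0 <= w,
    x + k * z + k * w = s & x ^+ 2 + z ^+ 2 + w ^+ 2 = n].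
Proof.
move=> k0 s0 hs hn hns; pose D := 2 * k ^+ 2 + 1.
have k2 : 0 < k ^+ 2 by rewrite exprn_gt0.
have D0 : 0 < D by rewrite /D; lra.
have Dne : D != 0 by rewrite gt_eqF.
have Dne' : 2 * k ^+ 2 + 1 != 0 by exact: Dne.
have kne : k != 0 by rewrite gt_eqF.
pose al := (s / D - x0) / (2 * k); pose be := (z0 - w0) / 2.
pose M := k * s / D.
have M0 : 0 < M by rewrite divr_gt0 // mulr_gt0.
have circle (a b : rat) : (s / D - 2 * k * a) ^+ 2 + (M + a + b) ^+ 2 + (M + a - b) ^+ 2
   = s ^+ 2 / D + 2 * (D * a ^+ 2 + b ^+ 2).
  by rewrite /M /D; field.
have ex : x0 = s / D - 2 * k * al by rewrite /al; field; rewrite ?kne ?Dne.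
have esum : z0 + w0 = 2 * (M + al).
  have : k * (z0 + w0) = s - x0 by rewrite -hs; ring.
  by move=> h; apply: (mulfI kne); rewrite h /M /al /D; field; rewrite ?kne ?Dne'.
have e2 : M + al = (z0 + w0) / 2 by rewrite esum; field.
have ez : z0 = M + al + be by rewrite e2 /be; field.
have ew : w0 = M + al - be by rewrite e2 /be; field.
have hrho : s ^+ 2 / D + 2 * (D * al ^+ 2 + be ^+ 2) = n.
  by rewrite -circle -ex -ez -ew.
have lt : D * al ^+ 2 + be ^+ 2 < D * M ^+ 2.
  have : s ^+ 2 = s ^+ 2 / D + 2 * (D * M ^+ 2) by rewrite /M /D; field.
  lra.
have [a [b [hab hM]]] := conic_point D0 M0 lt.
have na : `|- `|a| | = `|a| by rewrite normrN normr_id.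
have sa : (- `|a|) ^+ 2 = a ^+ 2 by rewrite sqrrN real_normK ?num_real.
have a0 := normr_ge0 a.
have /andP[b1 b2] : - `|b| <= b <= `|b| by rewrite -ler_norml.
exists (s / D - 2 * k * (- `|a|)), (M - `|a| + b), (M - `|a| - b); split.
- have h1 : 0 <= s / D by rewrite divr_ge0 // ltW.
  have h2 : 0 <= 2 * k * `|a| by rewrite !mulr_ge0 // ltW.
  by rewrite mulrN opprK addr_ge0.
- by move: hM b1 b2; clear; move: M `|a| `|b| => u v w; lra.
- by move: hM b1 b2; clear; move: M `|a| `|b| => u v w; lra.
- by rewrite /M /D; field.
by rewrite circle sa hab hrho.
Qed.

(** * Order and signs of three squares modulo 7 and 23 *)

Section SignCheck.
Variables p k : nat.
Local Open Scope nat_scope.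

Definition sqr_mod (x : nat) := x * x %% p.

(** Whether some arrangement (x, y, z) of a, b, c up to signs has x + k y + k
    z = r modulo p. Exchanging the last two entries changes nothing, so only
    the first one is chosen. *)
Definition some_sign (a b c r : nat) : bool :=
  has (fun v => has (fun x => has (fun y => has (fun z =>
      (x + k * y + k * z) %% p == r) [:: v.2; p - v.2])
      [:: v.1.2; p - v.1.2]) [:: v.1.1; p - v.1.1])
    [:: (a, b, c); (b, a, c); (c, a, b)].

(** Residues up to p / 2 suffice, since a, b, c may change sign and only t^2
    and t^4 occur. *)
Definition sign_check : bool :=
  let I := iota 0 p./2.+1 in
  let T := [seq (sqr_mod (sqr_mod t), 2 * sqr_mod t %% p) | t <- I] in
  all (fun a => all (fun b => all (fun c =>
    let s := (sqr_mod a + sqr_mod b + sqr_mod c) %% p in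
    all (fun t => if (s + t.1 == 0) || (s + t.1 == p) then some_sign a b c t.2 else true) T)
    I) I) I.

End SignCheck.

Lemma sign_check7 : sign_check 7 1. Proof. by vm_compute. Qed.
Lemma sign_check23 : sign_check 23 3. Proof. by vm_compute. Qed.

Lemma int_half_residue (p : nat) (a : int) : (0 < p)%N ->
  exists (a0 : nat) (a1 q : int),
    [/\ (a0 < p./2.+1)%N, a1 ^+ 2 = a ^+ 2 & a1 = a0%:Z + p%:Z * q].
Proof.
move=> p0; have h := divz_eq a p%:Z.
have h1 : (0 <= (a %% p%:Z)%Z) by apply: modz_ge0; lia.
have h2 : (a %% p%:Z)%Z < p%:Z by apply: ltz_pmod; lia.
have [r er] : exists r : nat, (a %% p%:Z)%Z = r%:Z.
  by exists (absz (a %% p%:Z)%Z); rewrite gez0_abs.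
rewrite er in h h2; case: (ltnP r p./2.+1) => hr.
  by exists r, a, (a %/ p%:Z)%Z; split => //; rewrite {1}h; ring.
exists (p - r)%N, (- a), (- (a %/ p%:Z)%Z - 1); split.
- lia.
- by rewrite sqrrN.
by rewrite {1}h -subzn; [ring|lia].
Qed.

Lemma sqr_mod_cong (p : nat) (a : int) (a0 : nat) (q : int) : a = a0%:Z + p%:Z * q ->
  exists q', a ^+ 2 = (sqr_mod p a0)%:Z + p%:Z * q'.
Proof.
move=> ->; exists ((a0 * a0 %/ p)%N%:Z + 2 * a0%:Z * q + p%:Z * q ^+ 2).
rewrite /sqr_mod; have e : a0%:Z * a0%:Z = (a0 * a0 %% p)%N%:Z + p%:Z * (a0 * a0 %/ p)%N%:Z.
  by rewrite -!PoszM -PoszD addnC mulnC -divn_eq.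
have -> : (a0%:Z + p%:Z * q) ^+ 2 = a0%:Z * a0%:Z + p%:Z * (2 * a0%:Z * q + p%:Z * q ^+ 2).
  by ring.
by rewrite e; ring.
Qed.

(** A finite statement about residues modulo p. The arrangement found for the
    residues is applied to the integers. *)
Lemma signed_representative (p k : nat) (a b c t q : int) :
  (p = 7 /\ k = 1 \/ p = 23 /\ k = 3)%N ->
  a ^+ 2 + b ^+ 2 + c ^+ 2 + t ^+ 4 = p%:Z * q ->
  exists a' b' c' y, a' ^+ 2 + b' ^+ 2 + c' ^+ 2 = a ^+ 2 + b ^+ 2 + c ^+ 2 /\
     2 * t ^+ 2 - (a' + k%:Z * b' + k%:Z * c') = p%:Z * y.
Proof.
move=> hpk hq.
have p0 : (0 < p)%N by case: hpk => -[-> _].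
have hchk : sign_check p k.
  by case: hpk => -[-> ->]; [exact: sign_check7|exact: sign_check23].
have [a0 [a1 [qa [ha sa ea]]]] := int_half_residue a p0.
have [b0 [b1 [qb [hb sb eb]]]] := int_half_residue b p0.
have [c0 [c1 [qc [hc sc ec]]]] := int_half_residue c p0.
have [t0 [t1 [qt [ht st et]]]] := int_half_residue t p0.
have e4 (x : int) : x ^+ 4 = (x ^+ 2) ^+ 2 by rewrite -exprM.
move: hq; rewrite e4 -sa -sb -sc -st -e4 {a b c t sa sb sc st} => hq.
move: a1 b1 c1 t1 ea eb ec et hq => a b c t ea eb ec et hq.
have half r : (r < p./2.+1)%N -> (r <= p)%N by lia.
have [qa2 ea2] := sqr_mod_cong ea; have [qb2 eb2] := sqr_mod_cong eb.
have [qc2 ec2] := sqr_mod_cong ec; have [qt2 et2] := sqr_mod_cong et.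
have [qt4 et4] := sqr_mod_cong et2; rewrite -exprM in et4.
move/allP: hchk => /(_ a0); rewrite mem_iota ha => /(_ isT).
move/allP => /(_ b0); rewrite mem_iota hb => /(_ isT).
move/allP => /(_ c0); rewrite mem_iota hc => /(_ isT).
move/allP => /(_ (sqr_mod p (sqr_mod p t0), 2 * sqr_mod p t0 %% p)%N).
rewrite (map_f (fun t => (sqr_mod p (sqr_mod p t), 2 * sqr_mod p t %% p)%N)) ?mem_iota ?ht // => /(_ isT) /=.
have -> : (((sqr_mod p a0 + sqr_mod p b0 + sqr_mod p c0) %% p + sqr_mod p (sqr_mod p t0) == 0) ||
  ((sqr_mod p a0 + sqr_mod p b0 + sqr_mod p c0) %% p + sqr_mod p (sqr_mod p t0) == p))%N.
  have : (sqr_mod p (sqr_mod p t0) < p)%N by rewrite ltn_mod.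
  move: ea2 eb2 ec2 et4 hq; move: (sqr_mod p (sqr_mod p t0)) (sqr_mod p a0) (sqr_mod p b0) (sqr_mod p c0).
  move: (a ^+ 2) (b ^+ 2) (c ^+ 2) (t ^+ 4); clear -hpk.
  by case: hpk => -[-> _]; lia.
(* Replacing a residue by its opposite amounts to changing the sign of the
   integer. *)
have opp (x : int) (x0 : nat) : (x0 <= p)%N -> (exists qx, x = x0%:Z + p%:Z * qx) ->
   forall x1, x1 \in [:: x0; p - x0]%N -> exists x' qx', x' ^+ 2 = x ^+ 2 /\ x' = x1%:Z + p%:Z * qx'.
  move=> hx [qx ->] x1; rewrite !inE => /orP[] /eqP ->.
    by exists (x0%:Z + p%:Z * qx), qx.
  exists (- (x0%:Z + p%:Z * qx)), (- qx - 1); split; first by rewrite sqrrN.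
  by rewrite -subzn //; ring.
have fin (x y z : int) (x0 y0 z0 : nat) :
  (exists qx, x = x0%:Z + p%:Z * qx) -> (exists qy, y = y0%:Z + p%:Z * qy) ->
  (exists qz, z = z0%:Z + p%:Z * qz) -> (x0 <= p)%N -> (y0 <= p)%N -> (z0 <= p)%N ->
  x ^+ 2 + y ^+ 2 + z ^+ 2 = a ^+ 2 + b ^+ 2 + c ^+ 2 ->
  has (fun x1 => has (fun y1 => has (fun z1 =>
      ((x1 + k * y1 + k * z1) %% p == 2 * sqr_mod p t0 %% p)%N) [:: z0; p - z0]%N)
      [:: y0; p - y0]%N) [:: x0; p - x0]%N ->
  exists a' b' c' y', a' ^+ 2 + b' ^+ 2 + c' ^+ 2 = a ^+ 2 + b ^+ 2 + c ^+ 2 /\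
     2 * t ^+ 2 - (a' + k%:Z * b' + k%:Z * c') = p%:Z * y'.
  move=> ex ey ez hx hy hz hsum /hasP [x1 hx1 /hasP [y1 hy1 /hasP [z1 hz1 /eqP hmod]]].
  have [x' [qx [sx Ex]]] := opp x x0 hx ex x1 hx1.
  have [y' [qy [sy Ey]]] := opp y y0 hy ey y1 hy1.
  have [z' [qz [sz Ez]]] := opp z z0 hz ez z1 hz1.
  have [w hw] : exists w, 2 * t ^+ 2 - (x' + k%:Z * y' + k%:Z * z') = p%:Z * w.
    exists (2 * qt2 - qx - k%:Z * qy - k%:Z * qz +
      ((2 * sqr_mod p t0) %/ p)%N%:Z - ((x1 + k * y1 + k * z1) %/ p)%N%:Z).
    have h1 := divn_eq (2 * sqr_mod p t0) p; have h2 := divn_eq (x1 + k * y1 + k * z1) p.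
    rewrite et2 Ex Ey Ez; rewrite hmod in h2.
    have {}h1 : 2 * (sqr_mod p t0)%:Z = ((2 * sqr_mod p t0) %/ p)%N%:Z * p%:Z + ((2 * sqr_mod p t0) %% p)%N%:Z.
      by rewrite -PoszM -PoszD -h1 PoszM.
    have {}h2 : x1%:Z + k%:Z * y1%:Z + k%:Z * z1%:Z =
       ((x1 + k * y1 + k * z1) %/ p)%N%:Z * p%:Z + ((2 * sqr_mod p t0) %% p)%N%:Z.
      by rewrite -!PoszM -!PoszD -h2.
    move: h1 h2; move: ((2 * sqr_mod p t0) %/ p)%N ((2 * sqr_mod p t0) %% p)%N
      ((x1 + k * y1 + k * z1) %/ p)%N => u v w' h1 h2.
    rewrite mulrDr h1.
    transitivity (u%:Z * p%:Z + v%:Z + 2 * (p%:Z * qt2) -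
      (x1%:Z + k%:Z * y1%:Z + k%:Z * z1%:Z) - p%:Z * (qx + k%:Z * qy + k%:Z * qz)); first by ring.
    by rewrite h2; ring.
  by exists x', y', z', w; rewrite sx sy sz.
rewrite /some_sign /= => /or4P[] //.
- apply: (fin a b c a0 b0 c0) => //; try exact: half; by [exists qa|exists qb|exists qc].
- apply: (fin b a c b0 a0 c0) => //; try exact: half; try by [exists qa|exists qb|exists qc].
  by ring.
- apply: (fin c a b c0 a0 b0) => //; try exact: half; try by [exists qa|exists qb|exists qc].
  by ring.
Qed.

(** * From three squares to four squares with a square linear form *)

Definition representable (k : nat) (S : rat -> Prop) (m : nat) : Prop :=
  exists (x : rat) (y : nat) (z w : rat),
    [/\ 0 <= x, 0 <= z, 0 <= w,
        m%:R = x ^+ 2 + y%:R ^+ 2 + z ^+ 2 + w ^+ 2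
      & S (x + 2 * y%:R + k%:R * z + k%:R * w)].

(** Invert Euler's identity: the vector p (x0, y, z0, w0) is T (1, 2, k, k)
    plus a combination of three vectors of squared length p orthogonal to (1,
    2, k, k). The coordinate y is an integer by choice of a, b, c. The
    rational point (x0, z0, w0) may have negative entries; it is replaced by
    another one on the same circle. *)
Lemma representable_of_sum3sq (p k m t : nat) :
  (p = 7 /\ k = 1 \/ p = 23 /\ k = 3)%N ->
  ((2 * k ^ 2 + 1) * m <= t ^ 4)%N -> (5 * m < t ^ 4)%N ->
  sum3sq ((p * m)%N%:Z - (t ^ 4)%N%:Z) -> representable k int_square m.
Proof.
move=> hpk hD h5 [a0 [b0 [c0 hN]]].
have natX (n j : nat) : (n ^ j)%N%:Z = n%:Z ^+ j by rewrite -!natz natrX.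
have ep : p%:Z = 2 * k%:Z ^+ 2 + 5 by case: hpk => -[-> ->].
have p0 : (0 < p%:Z) by case: hpk => -[-> _].
have k0 : (0 < k%:Z) by case: hpk => -[_ ->].
have [|a [b [c [y [hsum hy]]]]] := @signed_representative p k a0 b0 c0 t%:Z m%:Z hpk.
  by rewrite -hN PoszM natX subrK.
rewrite -hsum {hsum a0 b0 c0} PoszM in hN.
have et4 : (t ^ 4)%N%:Z = (t%:Z ^+ 2) ^+ 2 by rewrite -exprM natX.
have {}hD : (2 * k%:Z ^+ 2 + 1) * m%:Z <= (t%:Z ^+ 2) ^+ 2.
  by rewrite -et4 -natX; move: hD; rewrite -lez_nat PoszM PoszD PoszM.
have {}h5 : 5 * m%:Z < (t%:Z ^+ 2) ^+ 2 by rewrite -et4 -PoszM ltz_nat.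
rewrite et4 in hN.
set T := t%:Z ^+ 2 in hN hD h5 hy.
have T0 : 0 <= T by apply: sqr_ge0.
set K := k%:Z in ep hD hy k0; set P := p%:Z in ep p0 hy hN; set m' := m%:Z in hD h5 hN.
set L := a + K * b + K * c in hy.
(* Cauchy-Schwarz for the vectors (1, K, K) and (a, b, c). *)
have cs : L ^+ 2 <= (2 * K ^+ 2 + 1) * (P * m' - T ^+ 2).
  rewrite hN -subr_ge0.
  have -> : (2 * K ^+ 2 + 1) * (a ^+ 2 + b ^+ 2 + c ^+ 2) - L ^+ 2 =
     (K * c - K * b) ^+ 2 + (K * a - c) ^+ 2 + (b - K * a) ^+ 2 by rewrite /L; ring.
  by rewrite !addr_ge0 ?sqr_ge0.
have L2 : L ^+ 2 <= 4 * T ^+ 2.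
  apply: le_trans cs _.
  have : P * ((2 * K ^+ 2 + 1) * m') <= P * T ^+ 2 by rewrite ler_pM2l.
  by rewrite {2}ep; lra.
have y0 : 0 <= y.
  rewrite -(pmulr_rge0 _ p0) -hy subr_ge0.
  rewrite leNgt; apply/negP => h; have : (2 * T) ^+ 2 < L ^+ 2.
    by rewrite ltr_pXn2r // nnegrE; lra.
  lra.
case: y y0 hy => // y _ hy.
pose rT : rat := t%:R ^+ 2; pose rK : rat := k%:R; pose rP : rat := p%:R.
pose ra : rat := a%:~R; pose rb : rat := b%:~R; pose rc : rat := c%:~R.
have reP : rP = 2 * rK ^+ 2 + 5.
  have /(congr1 (fun x : int => x%:~R : rat)) := ep.
  by rewrite /= rmorphD rmorphM /= rmorphXn.
have rP0 : 0 < rP by rewrite /rP; case: hpk => -[-> _].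
have rPne : rP != 0 by rewrite gt_eqF.
have rhN : rP * m%:R - rT ^+ 2 = ra ^+ 2 + rb ^+ 2 + rc ^+ 2.
  have /(congr1 (fun x : int => x%:~R : rat)) := hN.
  by rewrite /= rmorphB !rmorphD rmorphM /= [(T ^+ 2)%:~R]rmorphXn [(a ^+ 2)%:~R]rmorphXn
    [(b ^+ 2)%:~R]rmorphXn [(c ^+ 2)%:~R]rmorphXn /= [T%:~R]rmorphXn.
have rhy : 2 * rT - (ra + rK * rb + rK * rc) = rP * y%:R.
  have /(congr1 (fun x : int => x%:~R : rat)) := hy.
  by rewrite /= /L !(rmorphB, rmorphD, rmorphM).
have rh5 : 5 * m%:R < rT ^+ 2.
  have : (5 * m')%:~R < (T ^+ 2)%:~R :> rat by rewrite ltr_int.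
  by rewrite rmorphM [(T ^+ 2)%:~R]rmorphXn /= [T%:~R]rmorphXn.
have rT0 : 0 <= rT by rewrite /rT sqr_ge0.
have rk0 : 0 < rK by rewrite /rK; case: hpk => -[_ ->].
pose x0 := (rT + 2 * ra + rK * (rc - rb)) / rP.
pose z0 := (rK * rT + 2 * rb + rK * ra - rc) / rP.
pose w0 := (rK * rT + 2 * rc + rb - rK * ra) / rP.
have ey : y%:R = (2 * rT - (ra + rK * rb + rK * rc)) / rP by rewrite rhy; field.
have es : x0 + rK * z0 + rK * w0 = rT - 2 * y%:R.
  rewrite ey /x0 /z0 /w0.
  transitivity (((2 * rK ^+ 2 + 1) * rT + 2 * (ra + rK * rb + rK * rc)) / rP).
    by field.
  have -> : 2 * rK ^+ 2 + 1 = rP - 4 by rewrite reP; ring.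
  by field.
have en : x0 ^+ 2 + z0 ^+ 2 + w0 ^+ 2 = m%:R - y%:R ^+ 2.
  apply/eqP; rewrite -subr_eq0 opprB addrA subr_eq0; apply/eqP.
  rewrite ey /x0 /z0 /w0.
  transitivity ((2 * rK ^+ 2 + 5) * (rT ^+ 2 + (ra ^+ 2 + rb ^+ 2 + rc ^+ 2)) / rP ^+ 2).
    by field.
  by rewrite -reP -rhN; field.
(* 5 ((T - 2 y)^2 + y^2 - m) = (5 y - 2 T)^2 + T^2 - 5 m: so 5 m < T^2 is what
   the lemma on the circle asks for. *)
have sgt : m%:R - y%:R ^+ 2 < (rT - 2 * y%:R) ^+ 2.
  rewrite -subr_gt0; have : 0 < (5 * y%:R - 2 * rT) ^+ 2 + (rT ^+ 2 - 5 * m%:R).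
    by rewrite ltr_wpDl ?sqr_ge0 ?subr_gt0.
  by move: (y%:R : rat) (m%:R : rat); clear => u v; lra.
have n0 : 0 <= m%:R - y%:R ^+ 2 :> rat by rewrite -en !addr_ge0 ?sqr_ge0.
have s0 : 0 < rT - 2 * y%:R.
  rewrite ltNge; apply/negP => h.
  have : rT ^+ 2 <= (2 * y%:R) ^+ 2 by rewrite ler_pXn2r ?nnegrE //; lra.
  have := ler0n rat m; lra.
have [x [z [w [hx hz hw hs hn]]]] := nonneg_point_on_circle rk0 s0 es en sgt.
exists x, y, z, w; split => //.
  by rewrite -addrA -addrA addrCA addrA [z ^+ 2 + _]addrC addrA in hn * ; lra.
exists t%:Z; have -> : x + 2 * y%:R + rK * z + rK * w = (x + rK * z + rK * w) + 2 * y%:R by ring.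
by rewrite hs subrK.
Qed.

(** * The choice of the fourth power *)

Definition ternary_class4 (n : nat) : bool :=
  [|| n == 0, ternary_class n | (n %% 4 == 0) && ternary_class (n %/ 4)]%N.

Lemma sum3sq_class4 n : ternary_class4 n -> sum3sq n%:Z.
Proof.
case/or3P => [/eqP ->|/three_squares //|/andP[/eqP n4 /three_squares h]].
  by exists 0, 0, 0; rewrite expr0n.
have -> : n%:Z = 2 ^+ 2 * (n %/ 4)%N%:Z by rewrite {1}(divn_eq n 4) n4 addn0 PoszM mulrC.
exact: sum3sqZ.
Qed.

Lemma fourth_power_mod16 t : (t ^ 4 %% 16 = odd t)%N.
Proof.
rewrite -modnXm -(@odd_mod t 16) //; have := ltn_pmod t (isT : 0 < 16)%N.
by case: (t %% 16)%N => [|[|[|[|[|[|[|[|[|[|[|[|[|[|[|[|]]]]]]]]]]]]]]]].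
Qed.

(** The parity of t for which p m - t^4 is a sum of three squares, when p = 7
    modulo 8. Fourth powers are 0 or 1 modulo 16, so the parity decides p m -
    t^4 modulo 16. *)
Definition root_parity (m : nat) : bool := (m %% 8 \in [:: 1; 2; 4; 5; 6])%N.

(** Finite check modulo 16. The difference is divisible by 4 only for m = 8
    modulo 16; it is then 8 modulo 16, and dividing it by 4 leaves a number
    that is 2 modulo 4. *)
Lemma ternary_class4_sub p m t n : (p %% 8 = 7)%N -> (m %% 16 != 0)%N ->
  odd t = root_parity m -> (n + t ^ 4 = p * m)%N -> ternary_class4 n.
Proof.
move=> p8 m16 ot E.
have hmod : ((n %% 16 + odd t) %% 16 = ((p %% 16) * (m %% 16)) %% 16)%N.
  by rewrite -fourth_power_mod16 modnDm E modnMm.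
have p16 : (p %% 16 = 7)%N \/ (p %% 16 = 15)%N by lia.
have n4 : (n %% 4 = (n %% 16) %% 4)%N by rewrite modn_dvdm.
have n8 : (n %% 8 = (n %% 16) %% 8)%N by rewrite modn_dvdm.
have q4 : (n %% 16 = 8 -> (n %/ 4) %% 4 = 2)%N by lia.
move: hmod; rewrite ot /root_parity -(@modn_dvdm 16 m 8) // /ternary_class4 /ternary_class n4 n8.
move: m16 q4; have := ltn_pmod m (isT : 0 < 16)%N; have := ltn_pmod n (isT : 0 < 16)%N.
case: p16 => ->; case: (m %% 16)%N => [|[|[|[|[|[|[|[|[|[|[|[|[|[|[|[|]]]]]]]]]]]]]]]] //;
 case: (n %% 16)%N => [|[|[|[|[|[|[|[|[|[|[|[|[|[|[|[|]]]]]]]]]]]]]]]] // _ _ _ q4 // _;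
 by try rewrite (q4 erefl); rewrite /= ?orbT.
Qed.

Lemma fourth_root n : exists t, (t ^ 4 <= n < t.+1 ^ 4)%N.
Proof.
have ex : exists t, (t ^ 4 <= n)%N by exists 0%N.
have ub t : (t ^ 4 <= n)%N -> (t <= n)%N.
  by apply: leq_trans; case: t => // t; rewrite -[leqLHS]expn1 leq_pexp2l.
case: (ex_maxnP ex ub) => t ht hmax; exists t; rewrite ht /=.
by rewrite ltnNge; apply/negP => /hmax; rewrite ltnn.
Qed.

(** The largest fourth power up to p m, or the preceding one, has the right
    parity. The bound c makes the ratio (t / (t + 2))^4 at least (2 k^2 + 1) /
    p and more than 5 / p: for p = 7 these are 3 / 7 and 5 / 7, for p = 23
    they are 19 / 23 and 5 / 23. *)
Lemma representable_large (p k c m : nat) :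
  (p = 7 /\ k = 1 /\ c = 25 \/ p = 23 /\ k = 3 /\ c = 42)%N ->
  (m %% 16 != 0)%N -> (c ^ 4 <= p * m)%N -> representable k int_square m.
Proof.
move=> hpk m16 hc.
have [t0 /andP[ht0 ht1]] := fourth_root (p * m).
have ct : (c <= t0)%N by rewrite -ltnS -(ltn_exp2r _ _ (isT : 0 < 4)%N); apply: leq_ltn_trans ht1.
have [t [tp [t4 t5 ct']]] : exists t, odd t = root_parity m /\
    [/\ (t ^ 4 <= p * m)%N, (p * m < (t + 2) ^ 4)%N & (c <= t.+1)%N].
  case: (eqVneq (odd t0) (root_parity m)) => [e|ne].
    exists t0; split => //; split => //; last lia.
    by apply: leq_trans ht1 _; rewrite leq_exp2r //; lia.
  exists t0.-1; split.
    by case: t0 ne ct {ht0 ht1} => [|t0]; [case: hpk => -[_ [_ ->]]|rewrite /=; case: odd; case: root_parity].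
  split; last lia.
    by apply: leq_trans ht0; rewrite leq_exp2r ?leq_pred.
  by apply: leq_trans ht1 _; rewrite leq_exp2r //; lia.
have m0 : (0 < m)%N by case: m m16 {hc ht0 ht1 tp t4 t5}.
have e4 x : (x ^ 4 = (x ^ 2) ^ 2)%N by rewrite -expnM.
have hb : ((2 * k ^ 2 + 1) * m <= t ^ 4)%N /\ (5 * m < t ^ 4)%N.
  move: t5; rewrite !e4; case: hpk => -[-> [-> ec]]; rewrite ec in ct'.
    have h1 : (50 * (t + 2) ^ 2 <= 59 * t ^ 2)%N by nia.
    have h2 : (2500 * ((t + 2) ^ 2) ^ 2 <= 3481 * (t ^ 2) ^ 2)%N.
      by have := leq_mul h1 h1; rewrite -!mulnn; lia.
    lia.
  have h1 : (10 * (t + 2) ^ 2 <= 11 * t ^ 2)%N by nia.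
  have h2 : (100 * ((t + 2) ^ 2) ^ 2 <= 121 * (t ^ 2) ^ 2)%N.
    by have := leq_mul h1 h1; rewrite -!mulnn; lia.
  lia.
apply: (@representable_of_sum3sq p k m t); [|by case: hb|by case: hb|].
  by case: hpk => -[-> [-> _]]; [left|right].
have -> : (p * m)%N%:Z - (t ^ 4)%N%:Z = (p * m - t ^ 4)%N%:Z by rewrite subzn.
apply: sum3sq_class4; apply: (@ternary_class4_sub p m t) => //; last by rewrite subnK.
by case: hpk => -[-> _].
Qed.

Lemma representable_scale k (S : rat -> Prop) m :
  (forall r, S r -> S (4 * r)) -> representable k S m -> representable k S (16 * m).
Proof.
move=> hS [x [y [z [w [x0 z0 w0 hm hs]]]]].
exists (4 * x), (4 * y)%N, (4 * z), (4 * w); split; rewrite ?mulr_ge0 //.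
  by rewrite !natrM hm; ring.
have -> : 4 * x + 2 * (4 * y)%:R + k%:R * (4 * z) + k%:R * (4 * w) =
   4 * (x + 2 * y%:R + k%:R * z + k%:R * w) by rewrite natrM; ring.
exact: hS.
Qed.

(** * Small integers, by computation *)

(** Nested conditionals are used in place of conjunctions, so that evaluation
    by value stops at the first test that fails. Only the implications from
    the tests to representability are proved, so the searches need no
    justification: they are heuristics that end in a verified test. *)
Module Compute.
Local Open Scope N_scope.

Fixpoint any (n : nat) (f : N -> bool) (i : N) : bool :=
  match n with
  | O => false
  | S n' => if f i then true else any n' f (N.succ i)
  end.

Fixpoint all_range (f : N -> bool) (lo : N) (len : positive) : bool :=
  match len with
  | xH => f lo
  | xO q => if all_range f lo q then all_range f (lo + Npos q) q else false
  | xI q => if f lo then if all_range f (N.succ lo) q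
            then all_range f (N.succ lo + Npos q) q else false else false
  end.

(** Membership in [ternary_class] is read off the three lowest binary
    digits. *)
Definition class_pos (p : positive) : bool :=
  match p with
  | xH | xI (xO _) | xO (xI _) | xO xH | xI xH | xI (xI (xO _)) => true
  | _ => false
  end.

Definition classN (n : N) : bool :=
  match n with
  | N0 => true
  | Npos (xO (xO q)) => class_pos q
  | Npos q => class_pos q
  end.

Section Check.
Variables (integral : bool) (k D p : N).

Definition good_root (m t : N) : bool :=
  let t4 := t * t * t * t in
  if D * m <=? t4 then if 5 * m <? t4 then
    if t4 <=? p * m then classN (p * m - t4) else false
  else false else false.

(** The solution x / e, y, z / e, w / e, whose linear form is (a / d)^2. *)
Definition certifies (m e d a y x z w : N) : bool :=
  if e =? 0 then false else if d =? 0 then false else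
  if integral && negb (d =? 1) then false else
  if m * e * e =? x * x + z * z + w * w + y * y * e * e
  then d * d * (x + k * z + k * w + 2 * y * e) =? a * a * e else false.

(** For k = 1 and k = 3, D = 3 and D = 19 are 3 modulo 8, so 2 is inert in the
    quadratic field of discriminant - D. Twice D n - s^2 is a norm from it
    when the circle has a rational point, so D n - s^2 has odd 2-adic
    valuation; this rejects many circles early. *)
Fixpoint odd_val2 (q : positive) : bool :=
  match q with
  | xO (xO q') => odd_val2 q'
  | xO _ => true
  | _ => false
  end.

(** Integer points with q = z + w and d = w - z on the plane x + k z + k w = s
    and the sphere of squared radius n; then 2 (D n - s^2) = (D q - 2 k s)^2 +
    D d^2, which gives the first q worth trying. The residue test avoids most
    square roots. *)
Definition point (fuel : nat) (m t2 y : N) : bool :=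
  if 2 * y <? t2 then
  let s := t2 - 2 * y in
  let y2 := y * y in
  if y2 <=? m then
  let n := m - y2 in
  let s2 := s * s in
  let e := D * n in
  if s2 <=? e then
  let e' := e - s2 in
  if match e' with N0 => true | Npos q => odd_val2 q end then
  if n <=? s2 then
  any fuel (fun q =>
     if k * q <=? s then
     let x := s - k * q in
     let b := 2 * x * x + q * q in
     if b <=? 2 * n then
     let d2 := 2 * n - b in
     if (if N.odd d2 then N.land d2 7 =? 1 else N.land d2 3 =? 0) then
     let d := N.sqrt d2 in
     if d * d =? d2 then if d <=? q then
       certifies m 1 1 (N.sqrt t2) y x ((q - d) / 2) ((q + d) / 2)
     else false else false else false else false else false)
   ((2 * k * s - N.sqrt (2 * e')) / D)
  else false else false else false else false else false.

(** Tries T = t^2, (t - 1)^2, and so on, and for each T the first values of y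
    that Cauchy-Schwarz allows. *)
Definition search (fq fy : nat) (m t : N) : bool :=
  any (N.to_nat t) (fun i => let t2 := (t - i) * (t - i) in
    any fy (point fq m t2) ((2 * t2 - N.sqrt (D * (p * m - t2 * t2))) / p)) 0.

Variable certs : seq (N * N * N * N * N * N * N * N).
(** Tuples (m, e, d, a, y, x, z, w) for the integers out of reach of the
    search. *)
Definition certified (m : N) : bool :=
  has (fun c => let '(m', e, d, a, y, x, z, w) := c in
     if m =? m' then certifies m e d a y x z w else false) certs.

Definition small_ok (t m : N) : bool :=
  match m with
  | Npos (xO (xO (xO (xO _)))) => true
  | _ => if good_root m t then true else if good_root m (N.pred t) then true
         else if search 8 20 m t then true
         else if search 50 50 m t then true else certified m
  end.

Definition cdiv (a b : N) : N := (a + b - 1) / b.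
(** Grouping the m by the integral fourth root t of p m avoids extracting
    roots. *)
Definition check_level (t : N) : bool :=
  let lo := cdiv (t * t * t * t) p in
  let t' := N.succ t in
  let hi := cdiv (t' * t' * t' * t') p in
  match hi - lo with
  | N0 => true
  | Npos len => all_range (small_ok t) lo len
  end.

Definition check_below (bound : nat) : bool :=
  all (fun t => check_level (N.of_nat t)) (iota 0 bound).

End Check.

Definition solutions_k3 : seq (N * N * N * N * N * N * N * N) :=
[:: (0,1,1,0,0,0,0,0); (3,5,1,2,1,7,0,1); (7,5,1,3,2,7,1,5); (8,5,1,2,0,14,0,2);
  (23,5,1,4,3,17,5,6); (25,5,1,3,0,24,0,7); (40,5,1,4,0,26,0,18); (43,5,1,4,1,31,5,8);
  (55,7,1,4,1,50,5,11); (56,17,1,4,0,122,20,30); (97,5,1,5,6,38,0,9);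
  (120,5,1,6,4,38,0,34); (168,7,1,6,4,82,18,20); (172,5,1,6,6,54,0,22);
  (376,5,1,8,4,64,2,70) ].
Definition solutions_k1 : seq (N * N * N * N * N * N * N * N) :=
[:: (0,1,1,0,0,0,0,0); (4,1,1,2,2,0,0,0); (2,25,5,9,1,0,7,24); (7,25,5,13,2,11,23,35);
  (9,25,5,11,0,25,34,62); (11,9,3,8,1,7,19,20); (19,9,3,10,3,7,19,20);
  (23,3,1,3,2,1,1,13); (24,9,3,8,0,2,28,34); (25,7,1,3,2,1,2,32);
  (31,9,3,10,1,19,25,38); (34,3,1,3,1,2,2,17); (36,7,1,3,1,3,5,41);
  (49,25,5,17,0,66,85,138); (57,9,3,13,4,22,34,41); (62,7,1,4,4,3,6,47);
  (68,9,3,13,3,23,43,49); (72,9,3,10,0,10,16,74); (73,9,3,11,0,16,44,61);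
  (74,25,5,16,0,9,35,212); (82,9,3,10,0,1,20,79); (89,9,3,11,0,1,58,62);
  (119,3,1,4,1,1,10,31); (135,3,1,4,1,1,7,34); (139,9,3,13,0,23,67,79);
  (143,7,1,5,6,9,11,71); (166,3,1,4,0,5,5,38); (167,7,1,4,1,3,5,90);
  (168,3,1,4,0,2,8,38); (179,3,1,4,1,1,1,40); (184,7,1,4,0,6,12,94);
  (268,3,1,6,10,2,8,38); (292,3,1,5,1,7,13,49); (340,7,1,5,1,5,31,125);
  (424,9,3,16,0,8,82,166); (472,3,1,6,4,8,14,62); (552,3,1,6,4,2,14,68);
  (568,9,3,20,4,34,134,160); (583,3,1,7,10,1,25,61); (863,3,1,7,6,5,23,83);
  (2744,9,3,26,0,38,226,412) ].

End Compute.
Import Compute.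

Local Open Scope ring_scope.

Lemma any_sound n f i : any n f i = true -> exists j, f j = true.
Proof.
by elim: n i => [|n IH] i //=; case E: (f i) => h; [exists i|exact: IH h].
Qed.

Lemma all_range_sound f lo len : all_range f lo len = true ->
  forall n, (lo <= n)%num -> (n < lo + Npos len)%num -> f n = true.
Proof.
elim: len lo => [q IH|q IH|] lo /=.
- case E: (f lo) => //; case E1: all_range => // E2 n h1 h2.
  case: (N.eq_dec n lo) => [->//|ne].
  case: (N.lt_ge_cases n (N.succ lo + Npos q)) => h.
    by apply: (IH _ E1) => //; lia.
  by apply: (IH _ E2) => //; lia.
- case E1: all_range => // E2 n h1 h2.
  case: (N.lt_ge_cases n (lo + Npos q)) => h.
    by apply: (IH _ E1) => //; lia.
  by apply: (IH _ E2) => //; lia.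
move=> E n h1 h2; have -> : n = lo by lia.
by [].
Qed.

Definition square_kind (integral : bool) : rat -> Prop :=
  if integral then int_square else rat_square.

Local Notation ratN n := ((N.to_nat n)%:R : rat).

Lemma ratND a b : ratN (a + b)%num = ratN a + ratN b.
Proof. by rewrite N2Nat.inj_add natrD. Qed.
Lemma ratNM a b : ratN (a * b)%num = ratN a * ratN b.
Proof. by rewrite N2Nat.inj_mul natrM. Qed.

Lemma certifies_sound integral k m e d a y x z w :
  certifies integral k m e d a y x z w = true ->
  representable (N.to_nat k) (square_kind integral) (N.to_nat m).
Proof.
rewrite /certifies; case: N.eqb_spec => // e0; case: N.eqb_spec => // d0.
case Ei: (_ && _) => //; case: N.eqb_spec => // hm /N.eqb_eq hs.
have ratN0 n : n <> 0%num -> ratN n != 0 by rewrite pnatr_eq0; lia.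
have {}e0 := ratN0 _ e0; have {}d0 := ratN0 _ d0.
have {}hm : ratN m * ratN e ^+ 2 =
    ratN x ^+ 2 + ratN z ^+ 2 + ratN w ^+ 2 + ratN y ^+ 2 * ratN e ^+ 2.
  have h : ratN (m * e * e)%num = ratN (x * x + z * z + w * w + y * y * e * e)%num.
    by rewrite hm.
  rewrite !(ratND, ratNM) in h.
  by transitivity (ratN m * ratN e * ratN e); [ring|rewrite h; ring].
have {}hs : ratN d ^+ 2 * (ratN x + ratN k * ratN z + ratN k * ratN w + 2 * ratN y * ratN e)
   = ratN a ^+ 2 * ratN e.
  have h : ratN (d * d * (x + k * z + k * w + 2 * y * e))%num = ratN (a * a * e)%num.
    by rewrite hs.
  have e2 : ratN 2%num = 2 by [].
  rewrite !(ratND, ratNM) e2 in h.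
  by transitivity (ratN a * ratN a * ratN e); [rewrite -h; ring|ring].
exists (ratN x / ratN e), (N.to_nat y), (ratN z / ratN e), (ratN w / ratN e).
have hsq : ratN x / ratN e + 2 * ratN y + ratN k * (ratN z / ratN e) + ratN k * (ratN w / ratN e)
    = (ratN a / ratN d) ^+ 2.
  apply: (mulfI (expf_neq0 2 d0)); apply: (mulIf e0).
  transitivity (ratN a ^+ 2 * ratN e); last by field; rewrite d0.
  by rewrite -hs; field.
split; rewrite ?divr_ge0 ?ler0n //.
  apply: (mulIf (expf_neq0 2 e0)); rewrite hm; field.
  by [].
rewrite hsq /square_kind; case: integral Ei => [/=|_]; last by exists (ratN a / ratN d).
case: N.eqb_spec => // -> _; exists (N.to_nat a)%:Z.
by rewrite divr1.
Qed.

Lemma point_sound integral k D fuel m t2 y : point integral k D fuel m t2 y = true ->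
  representable (N.to_nat k) (square_kind integral) (N.to_nat m).
Proof.
rewrite /point; do 5! [case: ifP => // _].
move=> /any_sound [q]; do 5! [case: ifP => // _].
exact: certifies_sound.
Qed.

Lemma search_sound integral k D p fq fy m t : search integral k D p fq fy m t = true ->
  representable (N.to_nat k) (square_kind integral) (N.to_nat m).
Proof. by move=> /any_sound [i] /any_sound [y] /point_sound. Qed.

Lemma certified_sound integral k certs m : certified integral k certs m = true ->
  representable (N.to_nat k) (square_kind integral) (N.to_nat m).
Proof.
move=> /hasP [[[[[[[[m' e] d] a] y] x] z] w] _].
by case: ifP => // _ /certifies_sound.
Qed.

Lemma class_pos_sound q : class_pos q = true -> ternary_class (Pos.to_nat q).
Proof.
rewrite /ternary_class.
case: q => [[[q|q|]|[q|q|]|]|[[q|q|]|[q|q|]|]|] //= _; lia.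
Qed.

Lemma classN_sound n : classN n = true -> ternary_class4 (N.to_nat n).
Proof.
rewrite /ternary_class4; case: n => // -[q|[q|q|]|] h; try by rewrite (class_pos_sound h) orbT.
apply/orP; right; apply/orP; right.
have -> : (N.to_nat (Npos q~0~0) = 4 * Pos.to_nat q)%N by lia.
by rewrite modnMr mulKn // class_pos_sound.
Qed.

Section Sound.
Variables (integral : bool) (k D p : N).
Hypothesis hpk : (N.to_nat p = 7 /\ N.to_nat k = 1 \/ N.to_nat p = 23 /\ N.to_nat k = 3)%N.
Hypothesis hD : D = (2 * k * k + 1)%num.

Lemma good_root_sound m t : good_root D p m t = true ->
  representable (N.to_nat k) (square_kind integral) (N.to_nat m).
Proof.
rewrite /good_root.
case: N.leb_spec => // h1; case: N.ltb_spec => // h2; case: N.leb_spec => // h3 h4.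
have e4 : (N.to_nat (t * t * t * t) = N.to_nat t ^ 4)%N.
  by rewrite !N2Nat.inj_mul !expnS expn0 muln1 !mulnA.
have h : representable (N.to_nat k) int_square (N.to_nat m).
  apply: (@representable_of_sum3sq (N.to_nat p) _ _ (N.to_nat t)) => //.
  - rewrite -e4 -mulnn; move: h1; rewrite hD; lia.
  - by rewrite -e4; lia.
  rewrite subzn; last by rewrite -e4; lia.
  rewrite -e4; have -> : (N.to_nat p * N.to_nat m - N.to_nat (t * t * t * t) =
      N.to_nat (p * m - t * t * t * t))%N by lia.
  exact/sum3sq_class4/classN_sound.
rewrite /square_kind; case: integral => //.
have [x [y [z [w [x0 z0 w0 hm [s hs]]]]]] := h.
by exists x, y, z, w; split => //; exists s%:~R.
Qed.

Lemma small_ok_sound certs t m : small_ok integral k D p certs t m = true ->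
  (N.to_nat m %% 16 != 0)%N ->
  representable (N.to_nat k) (square_kind integral) (N.to_nat m).
Proof.
have gen : (if good_root D p m t then true
         else if good_root D p m (N.pred t) then true
         else if search integral k D p 8 20 m t then true
         else if search integral k D p 50 50 m t then true
         else certified integral k certs m) = true ->
   representable (N.to_nat k) (square_kind integral) (N.to_nat m).
  case: ifP => [/good_root_sound //|_]; case: ifP => [/good_root_sound //|_].
  case: ifP => [/search_sound //|_]; case: ifP => [/search_sound //|_].
  exact: certified_sound.
rewrite /small_ok; case: m gen => [//|[q|[q|[q|[q|q|]|]|]|]] gen h m16; try exact: gen.
exfalso; move: m16; lia.
Qed.

Lemma check_below_sound certs bound :
  check_below integral k D p certs bound = true ->
  forall m, (N.to_nat m %% 16 != 0)%N -> (N.to_nat p * N.to_nat m < bound ^ 4)%N ->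
  representable (N.to_nat k) (square_kind integral) (N.to_nat m).
Proof.
move=> hchk m m16 hm.
have [t /andP[ht1 ht2]] := fourth_root (N.to_nat p * N.to_nat m).
have tb : (t < bound)%N.
  by rewrite -(ltn_exp2r _ _ (isT : 0 < 4)%N); apply: leq_ltn_trans hm.
move/allP: hchk => /(_ t); rewrite mem_iota tb => /(_ isT).
rewrite /check_level; set T := N.of_nat t.
have e4 x : (N.to_nat (x * x * x * x) = N.to_nat x ^ 4)%N.
  by rewrite !N2Nat.inj_mul !expnS expn0 muln1 !mulnA.
have p0 : (0 < p)%num by case: hpk => -[h _]; lia.
have h1 : (T * T * T * T <= p * m)%num.
  by apply/N.lt_eq_cases; have := e4 T; rewrite /T Nat2N.id; lia.
have h2 : (p * m < N.succ T * N.succ T * N.succ T * N.succ T)%num.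
  by have := e4 (N.succ T); rewrite N2Nat.inj_succ /T Nat2N.id; lia.
set lo := cdiv (T * T * T * T) p; set hi := cdiv _ p.
have hlo : (lo <= m)%num.
  rewrite /lo /cdiv; apply/N.lt_succ_r; apply: N.Div0.div_lt_upper_bound; lia.
have hhi : (m < hi)%num.
  rewrite /hi /cdiv; apply/N.le_succ_l; apply: N.div_le_lower_bound; lia.
case E: (hi - lo)%num => [|len]; first by lia.
move=> /all_range_sound /(_ m hlo) h; apply: (small_ok_sound (h _)) => //.
by rewrite -E; lia.
Qed.

End Sound.

Lemma check_below_k1 : check_below false 1 3 7 solutions_k1 25. Proof. by vm_compute. Qed.
Lemma check_below_k3 : check_below true 3 19 23 solutions_k3 42. Proof. by vm_compute. Qed.

(** * Four squares of nonnegative fifths *)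

(** The unknowns are multiplied by 5. *)
Definition fifths (m T : int) : Prop :=
  exists X Y Z W : int, [/\ [/\ 0 <= X, 0 <= Y, 0 <= Z & 0 <= W],
    X ^+ 2 + Y ^+ 2 + Z ^+ 2 + W ^+ 2 = 25 * m & X + Y + 2 * Z + 3 * W = 5 * T].

(** Orthogonal vectors of squared length 15 give 15 times the solution;
    dividing by 3 leaves the unknowns multiplied by 5. *)
Lemma fifths_of_thirds (m T X Y Z W : int) :
  [/\ 0 <= X, 0 <= Y, 0 <= Z & 0 <= W] ->
  [/\ (X %% 3)%Z = 0, (Y %% 3)%Z = 0, (Z %% 3)%Z = 0 & (W %% 3)%Z = 0] ->
  X ^+ 2 + Y ^+ 2 + Z ^+ 2 + W ^+ 2 = 225 * m ->
  X + Y + 2 * Z + 3 * W = 15 * T -> fifths m T.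
Proof.
have quo (A : int) : 0 <= A -> (A %% 3)%Z = 0 -> exists A', 0 <= A' /\ A = 3 * A'.
  by move=> A0 A3; exists (A %/ 3)%Z; lia.
move=> [X0 Y0 Z0 W0] [X3 Y3 Z3 W3].
have [x [x0 ->]] := quo X X0 X3; have [y [y0 ->]] := quo Y Y0 Y3.
have [z [z0 ->]] := quo Z Z0 Z3; have [w [w0 ->]] := quo W W0 W3.
move=> hs hl; exists x, y, z, w; split => //; last by lia.
by move: hs; rewrite !exprMn; lia.
Qed.

(** Cauchy-Schwarz against (1, 0, 0), (1, 1, 0) and (1, 1, 1); 3 / 2 and 2
    bound the square roots of 2 and 3 from above. *)
Lemma norm_bounds (T a b c : int) : 0 <= T -> a ^+ 2 + b ^+ 2 + c ^+ 2 <= T ^+ 2 ->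
  [/\ a <= T, 2 * (a + b) <= 3 * T & a + b + c <= 2 * T].
Proof.
move=> T0 h; have a2 := sqr_ge0 a; have b2 := sqr_ge0 b; have c2 := sqr_ge0 c.
split; rewrite leNgt; apply/negP => hc.
- have : T ^+ 2 < a ^+ 2 by rewrite ltr_pXn2r // nnegrE; lia.
  lia.
- have : (3 * T) ^+ 2 < (2 * (a + b)) ^+ 2 by rewrite ltr_pXn2r // nnegrE; lia.
  have -> : (2 * (a + b)) ^+ 2 = 8 * (a ^+ 2 + b ^+ 2) - 4 * (a - b) ^+ 2 by ring.
  by have := sqr_ge0 (a - b); rewrite exprMn; lia.
have : (2 * T) ^+ 2 < (a + b + c) ^+ 2 by rewrite ltr_pXn2r // nnegrE; lia.
have -> : (a + b + c) ^+ 2 = 3 * (a ^+ 2 + b ^+ 2 + c ^+ 2) - (a - b) ^+ 2 - (b - c) ^+ 2 - (a - c) ^+ 2 by ring.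
by have := sqr_ge0 (a - b); have := sqr_ge0 (b - c); have := sqr_ge0 (a - c); rewrite exprMn; lia.
Qed.

Section Frames.
Variables (m T : int).
Hypothesis T0 : 0 <= T.

(** The four entries are T (1, 1, 2, 3) plus a combination of a, b, c with
    coefficients in an orthogonal basis of vectors of squared length 15, so
    that the quadratic and linear conditions are identities. Divisibility by 3
    and nonnegativity are left to linear arithmetic. *)
Ltac frame hN X Y Z W :=
  apply: (@fifths_of_thirds m T X Y Z W);
  [ split; lia | split; lia
  | transitivity (15 * (T ^+ 2 + (15 * m - T ^+ 2))); [rewrite -hN; ring | ring]
  | ring ].

(** If 3 divides T, signs can be chosen so that a, b, c have equal residues,
    and then all entries below are divisible by 3. The order of a, b, c and
    the sign of b ensure nonnegativity. *)
Lemma fifths_T0_sorted a b c : a ^+ 2 + b ^+ 2 + c ^+ 2 = 15 * m - T ^+ 2 ->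
  a ^+ 2 + b ^+ 2 + c ^+ 2 <= T ^+ 2 -> (T %% 3)%Z = 0 ->
  (a %% 3)%Z = (b %% 3)%Z -> (b %% 3)%Z = (c %% 3)%Z ->
  b <= a -> c <= b -> 0 <= b -> fifths m T.
Proof.
move=> hN hT T3 ab bc sab sbc b0.
have [a1 ab1 abc1] := norm_bounds T0 hT.
have [c1 bc2 _] : [/\ - c <= T, 2 * (- c + a) <= 3 * T & - c + a + b <= 2 * T].
  by apply: norm_bounds => //; rewrite sqrrN; lia.
have [_ bc3 _] : [/\ - c <= T, 2 * (- c + b) <= 3 * T & - c + b + a <= 2 * T].
  by apply: norm_bounds => //; rewrite sqrrN; lia.
frame hN (T + 3 * a - 2 * b - c) (T + 2 * a + 3 * b + c)
  (2 * T - a + b - 3 * c) (3 * T - a - b + 2 * c).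
Qed.

(** Reversing all signs and the order reduces to a nonnegative middle term. *)
Lemma fifths_T0 a b c : a ^+ 2 + b ^+ 2 + c ^+ 2 = 15 * m - T ^+ 2 ->
  a ^+ 2 + b ^+ 2 + c ^+ 2 <= T ^+ 2 -> (T %% 3)%Z = 0 ->
  (a %% 3)%Z = (b %% 3)%Z -> (b %% 3)%Z = (c %% 3)%Z -> fifths m T.
Proof.
have sorted x y z : x ^+ 2 + y ^+ 2 + z ^+ 2 = 15 * m - T ^+ 2 ->
    x ^+ 2 + y ^+ 2 + z ^+ 2 <= T ^+ 2 -> (T %% 3)%Z = 0 ->
    (x %% 3)%Z = (y %% 3)%Z -> (y %% 3)%Z = (z %% 3)%Z ->
    y <= x -> z <= y -> fifths m T.
  move=> hN hT T3 xy yz sxy syz; case: (leP 0 y) => y0.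
    exact: (@fifths_T0_sorted x y z).
  by apply: (@fifths_T0_sorted (- z) (- y) (- x)) => //; rewrite ?sqrrN; lia.
move=> hN hT T3 ab bc.
case: (leP a b) => h1; case: (leP b c) => h2; case: (leP a c) => h3.
- by apply: (sorted c b a) => //; lia.
- by apply: (sorted c b a) => //; lia.
- by apply: (sorted b c a) => //; lia.
- by apply: (sorted b a c) => //; lia.
- by apply: (sorted c a b) => //; lia.
- by apply: (sorted a c b) => //; lia.
- by apply: (sorted a b c) => //; lia.
- by apply: (sorted a b c) => //; lia.
Qed.

(** If T is 1 modulo 3, exactly two of a, b, c are prime to 3, and their signs
    are fixed by the congruences; only c may change sign freely. The basis
    must therefore depend on the signs of a and b and, for negative a, on one
    further comparison. *)
Lemma fifths_T1_sorted a b c : a ^+ 2 + b ^+ 2 + c ^+ 2 = 15 * m - T ^+ 2 ->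
  a ^+ 2 + b ^+ 2 + c ^+ 2 <= T ^+ 2 -> (T %% 3)%Z = 1 ->
  (a %% 3)%Z = 1 -> (b %% 3)%Z = 1 -> (c %% 3)%Z = 0 ->
  b ^+ 2 <= a ^+ 2 -> 0 <= c -> fifths m T.
Proof.
move=> hN hT T3 a3 b3 c3 hab c0.
have bnd x y z : x ^+ 2 = a ^+ 2 -> y ^+ 2 = b ^+ 2 -> z ^+ 2 = c ^+ 2 ->
   [/\ [/\ x <= T, y <= T & z <= T],
       [/\ 2 * (x + y) <= 3 * T, 2 * (x + z) <= 3 * T & 2 * (y + z) <= 3 * T]
     & x + y + z <= 2 * T].
  move=> ex ey ez.
  have h1 : b ^+ 2 + c ^+ 2 + a ^+ 2 <= T ^+ 2 by lra.
  have h2 : c ^+ 2 + a ^+ 2 + b ^+ 2 <= T ^+ 2 by lra.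
  have [] : [/\ x <= T, 2 * (x + y) <= 3 * T & x + y + z <= 2 * T] by apply: norm_bounds => //; rewrite ex ey ez.
  have [] : [/\ y <= T, 2 * (y + z) <= 3 * T & y + z + x <= 2 * T] by apply: norm_bounds => //; rewrite ey ez ex.
  have [] : [/\ z <= T, 2 * (z + x) <= 3 * T & z + x + y <= 2 * T] by apply: norm_bounds => //; rewrite ez ex ey.
  by move=> *; split; [split|split|]; lia.
have le (x y : int) : 0 <= x -> y ^+ 2 <= x ^+ 2 -> y <= x.
  by move=> x0 h; rewrite leNgt; apply/negP => hc; have : x ^+ 2 < y ^+ 2 by [rewrite ltr_pXn2r // nnegrE; lia]; lia.
case: (leP 0 a) => a0; case: (leP 0 b) => b0.
- have [[b1 b2 b4] [b5 b6 b7] b8] := bnd a b c erefl erefl erefl.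
  have s := le a b a0 hab.
  frame hN (T + a - 2 * b + 3 * c) (T - a + 3 * b + 2 * c)
    (2 * T + 3 * a + b - c) (3 * T - 2 * a - b - c).
- have [[b1 b2 b4] [b5 b6 b7] b8] := bnd a (- b) c erefl (sqrrN b) erefl.
  have s : - b <= a by apply: le => //; rewrite sqrrN.
  frame hN (T + 3 * a + 2 * b + c) (T + 2 * a - 3 * b - c)
    (2 * T - a - b + 3 * c) (3 * T - a + b - 2 * c).
- have [[b1 b2 b4] [b5 b6 b7] b8] := bnd (- a) b c (sqrrN a) erefl erefl.
  have s : b <= - a by apply: le; rewrite ?sqrrN //; lia.
  case: (leP (2 * b + c) (- a)) => hs.
    frame hN (T - 3 * a + 2 * b - c) (T - a - 3 * b - 2 * c)
      (2 * T - a - b + 3 * c) (3 * T + 2 * a + b - c).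
  frame hN (T - 3 * a + 2 * b - c) (T + 2 * a + 3 * b + c)
    (2 * T - a - b + 3 * c) (3 * T + a - b - 2 * c).
have [[b1 b2 b4] [b5 b6 b7] b8] := bnd (- a) (- b) c (sqrrN a) (sqrrN b) erefl.
have s : - b <= - a by apply: le; rewrite ?sqrrN //; lia.
case: (leP c (- 3 * a)) => hs.
  frame hN (T - 3 * a - b - 2 * c) (T - 2 * a + b + 3 * c)
    (2 * T + a - 3 * b + c) (3 * T + a + 2 * b - c).
frame hN (T - 3 * a + 2 * b - c) (T + 2 * a + 3 * b + c)
  (2 * T - a - b + 3 * c) (3 * T + a - b - 2 * c).
Qed.

Lemma fifths_T1 a b c : a ^+ 2 + b ^+ 2 + c ^+ 2 = 15 * m - T ^+ 2 ->
  a ^+ 2 + b ^+ 2 + c ^+ 2 <= T ^+ 2 -> (T %% 3)%Z = 1 ->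
  (a %% 3)%Z = 1 -> (b %% 3)%Z = 1 -> (c %% 3)%Z = 0 -> fifths m T.
Proof.
wlog c0 : c / 0 <= c.
  move=> W hN hT T3 a3 b3 c3; case: (leP 0 c) => c0; first exact: (W c).
  by apply: (W (- c)); rewrite ?sqrrN //; lia.
move=> hN hT T3 a3 b3 c3; case: (leP (b ^+ 2) (a ^+ 2)) => h.
  exact: (@fifths_T1_sorted a b c).
by apply: (@fifths_T1_sorted b a c) => //; rewrite 1?[b ^+ 2 + _]addrC // ltW.
Qed.

Lemma normalize_mod3 (a : int) : exists a', a' ^+ 2 = a ^+ 2 /\
  ((a' %% 3)%Z = 0 \/ (a' %% 3)%Z = 1).
Proof.
have : [|| a %% 3 == 0, a %% 3 == 1 | a %% 3 == 2]%Z by lia.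
case/or3P => /eqP h.
- by exists a; split => //; left.
- by exists a; split => //; right.
- by exists (- a); split; [rewrite sqrrN|right; lia].
Qed.

(** T is a square, so 0 or 1 modulo 3, and modulo 3 the sum of the squares of
    a, b, c is - T. *)
Lemma fifths_of_sum3sq (t : int) : T = t ^+ 2 -> 15 * m <= 2 * T ^+ 2 ->
  sum3sq (15 * m - T ^+ 2) -> fifths m T.
Proof.
move=> eT hT [a0 [b0 [c0 hN]]].
have [a [sa ha]] := normalize_mod3 a0; have [b [sb hb]] := normalize_mod3 b0.
have [c [sc hc]] := normalize_mod3 c0; have [u [su hu]] := normalize_mod3 t.
rewrite -sa -sb -sc in hN; rewrite -su in eT.
have hA : a ^+ 2 + b ^+ 2 + c ^+ 2 <= T ^+ 2.
  by rewrite -hN; move: hT; clear; lra.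
have sq (x : int) r : (x %% 3)%Z = r -> exists q, x ^+ 2 = r ^+ 2 + 3 * q.
  move=> xr; exists (2 * (x %/ 3)%Z * r + 3 * (x %/ 3)%Z ^+ 2).
  by rewrite {1}(divz_eq x 3) xr; ring.
have sq01 (x : int) : (x %% 3)%Z = 0 \/ (x %% 3)%Z = 1 ->
   exists q, x ^+ 2 = (x %% 3)%Z + 3 * q.
  by case=> h; have [q ->] := sq x _ h; exists q; rewrite h; ring.
have [qa ea] := sq01 a ha; have [qb eb] := sq01 b hb; have [qc ec] := sq01 c hc.
have [qu eu] := sq01 u hu.
have T3 : (T %% 3)%Z = (u %% 3)%Z by rewrite eT eu; clear; lia.
have hT3 : (T %% 3)%Z = 0 \/ (T %% 3)%Z = 1 by rewrite T3.
have [qT eqT] := sq01 T hT3.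
have hs : exists q, (a %% 3)%Z + (b %% 3)%Z + (c %% 3)%Z + (u %% 3)%Z = 3 * q.
  exists (5 * m - qT - qa - qb - qc); move: hN; rewrite ea eb ec -T3.
  by move: eqT; clear; lra.
case: hs => q hs; have hN' := esym hN.
clear hT3 qa qb qc qu qT ea eb ec eu eqT eT hT hN sa sb sc su sq sq01 a0 b0 c0.
case: hu => u3; rewrite u3 in T3 hs.
  by apply: (@fifths_T0 a b c) => //; case: ha => ha; case: hb => hb; case: hc => hc; lia.
case: ha => ha; case: hb => hb; case: hc => hc; try (exfalso; lia).
- by apply: (@fifths_T1 b c a) => //; lia.
- by apply: (@fifths_T1 a c b) => //; lia.
- exact: (@fifths_T1 a b c).
Qed.

End Frames.

Definition fifth_rep (m : nat) : Prop := exists x y z w : rat,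
  [/\ [/\ nat_fifth x, nat_fifth y, nat_fifth z & nat_fifth w],
      m%:R = x ^+ 2 + y ^+ 2 + z ^+ 2 + w ^+ 2
    & int_square (x + y + 2 * z + 3 * w)].

Lemma fifth_rep_of_fifths (m : nat) (t : int) : fifths m%:Z (t ^+ 2) -> fifth_rep m.
Proof.
move=> [X [Y [Z [W [[X0 Y0 Z0 W0] hs hl]]]]].
case: X X0 hs hl => // X _; case: Y Y0 => // Y _; case: Z Z0 => // Z _.
case: W W0 => // W _ hs hl.
exists (X%:R / 5), (Y%:R / 5), (Z%:R / 5), (W%:R / 5); split.
- by split; [exists X|exists Y|exists Z|exists W].
- have h : X%:R ^+ 2 + Y%:R ^+ 2 + Z%:R ^+ 2 + W%:R ^+ 2 = 25 * m%:R :> rat.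
    have := congr1 (fun x : int => x%:~R : rat) hs.
    by rewrite /= !(rmorphD, rmorphM).
  by rewrite !expr_div_n -!mulrDl h; field.
exists t; have h : X%:R + Y%:R + 2 * Z%:R + 3 * W%:R = 5 * t%:~R ^+ 2 :> rat.
  have := congr1 (fun x : int => x%:~R : rat) hl.
  by rewrite /= !(rmorphD, rmorphM).
have -> : t%:~R ^+ 2 = (5 * t%:~R ^+ 2) / 5 :> rat by field.
by rewrite -h; field.
Qed.

Lemma fifth_rep_of_root m t : (t ^ 4 <= 15 * m)%N -> (15 * m <= 2 * t ^ 4)%N ->
  ternary_class4 (15 * m - t ^ 4) -> fifth_rep m.
Proof.
move=> h1 h2 hc; apply: (@fifth_rep_of_fifths m t%:Z).
have e4 : (t%:Z ^+ 2) ^+ 2 = (t ^ 4)%N%:Z by rewrite -exprM -!natz natrX.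
apply: (@fifths_of_sum3sq m%:Z (t%:Z ^+ 2) (sqr_ge0 _) t%:Z); rewrite // e4.
  by lia.
have -> : 15 * m%:Z - (t ^ 4)%N%:Z = (15 * m - t ^ 4)%N%:Z by lia.
exact: sum3sq_class4.
Qed.

(** From (t + 2)^4 to t^4 the ratio is below 2 when t >= 11. *)
Lemma fifth_rep_large m : (m %% 16 != 0)%N -> (12 ^ 4 <= 15 * m)%N -> fifth_rep m.
Proof.
move=> m16 hc; have [t0 /andP[ht0 ht1]] := fourth_root (15 * m).
have ct : (12 <= t0)%N by rewrite -ltnS -(ltn_exp2r _ _ (isT : 0 < 4)%N); apply: leq_ltn_trans ht1.
have [t [tp [t4 t5 ct']]] : exists t, odd t = root_parity m /\
    [/\ (t ^ 4 <= 15 * m)%N, (15 * m < (t + 2) ^ 4)%N & (11 <= t)%N].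
  case: (eqVneq (odd t0) (root_parity m)) => [e|ne].
    exists t0; split => //; split => //; last lia.
    by apply: leq_trans ht1 _; rewrite leq_exp2r //; lia.
  exists t0.-1; split.
    by case: t0 ne ct {ht0 ht1} => // t0; rewrite /=; case: odd; case: root_parity.
  split; last lia.
    by apply: leq_trans ht0; rewrite leq_exp2r ?leq_pred.
  by apply: leq_trans ht1 _; rewrite leq_exp2r //; lia.
apply: (@fifth_rep_of_root m t) => //; last first.
  by apply: (@ternary_class4_sub 15 m t) => //; rewrite subnK.
have e4 x : (x ^ 4 = (x ^ 2) ^ 2)%N by rewrite -expnM.
move: t5; rewrite !e4.
have h1 : (5 * (t + 2) ^ 2 <= 7 * t ^ 2)%N by nia.
have h2 : (25 * ((t + 2) ^ 2) ^ 2 <= 49 * (t ^ 2) ^ 2)%N.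
  by have := leq_mul h1 h1; rewrite -!mulnn; lia.
lia.
Qed.

Import Compute.

Module ComputeFifth.
Local Open Scope N_scope.
Definition certifies5 (m t x y z w : N) : bool :=
  if x * x + y * y + z * z + w * w =? 25 * m
  then x + y + 2 * z + 3 * w =? 5 * (t * t) else false.

(** Solutions whose entries have denominator q, for q = 1 or 5: choose z and
    w, then x and y are determined by their sum and the sum of their
    squares. *)
Definition search5 (q m t : N) : bool :=
  let M := q * q * m in
  any (N.to_nat t) (fun i => let s := q * ((t - i) * (t - i)) in
  any 100 (fun w => if w * w <=? M then if 3 * w <=? s then
  any 100 (fun z => let v := w * w + z * z in if v <=? M then
     if 3 * w + 2 * z <=? s then
     let u := s - (3 * w + 2 * z) in let n := M - v in
     if n <=? u * u then if u * u <=? 2 * n then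
     let d2 := 2 * n - u * u in let d := N.sqrt d2 in
     if d * d =? d2 then
       let c := 5 / q in
       certifies5 m (t - i) (c * ((u - d) / 2)) (c * ((u + d) / 2)) (c * z) (c * w)
     else false else false else false else false else false) 0
  else false else false) 0) 0.

Definition good_root5 (m t : N) : bool :=
  let t4 := t * t * t * t in
  if t4 <=? 15 * m then if 15 * m <=? 2 * t4 then classN (15 * m - t4) else false else false.

Definition small_ok5 (m : N) : bool :=
  match m with
  | Npos (xO (xO (xO (xO _)))) => true
  | _ => let t := N.sqrt (N.sqrt (15 * m)) in
         if good_root5 m t then true else if good_root5 m (N.pred t) then true
         else if search5 1 m t then true else search5 5 m t
  end.
End ComputeFifth.
Import ComputeFifth.

Lemma certifies5_sound m t x y z w : certifies5 m t x y z w = true -> fifth_rep (N.to_nat m).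
Proof.
rewrite /certifies5; case: N.eqb_spec => // h1 /N.eqb_eq h2.
apply: (@fifth_rep_of_fifths _ (N.to_nat t)%:Z).
exists (N.to_nat x)%:Z, (N.to_nat y)%:Z, (N.to_nat z)%:Z, (N.to_nat w)%:Z.
by split; [split|rewrite !expr2; lia|rewrite !expr2; lia].
Qed.

Lemma search5_sound q m t : search5 q m t = true -> fifth_rep (N.to_nat m).
Proof.
move=> /any_sound [i] /any_sound [w]; cbv beta zeta; do 2! [case: ifP => // _].
move=> /any_sound [z]; cbv beta zeta; do 5! [case: ifP => // _].
exact: certifies5_sound.
Qed.

Lemma good_root5_sound m t : good_root5 m t = true -> fifth_rep (N.to_nat m).
Proof.
rewrite /good_root5; case: N.leb_spec => // h1; case: N.leb_spec => // h2 h3.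
have e4 : (N.to_nat (t * t * t * t) = N.to_nat t ^ 4)%N.
  by rewrite !N2Nat.inj_mul !expnS expn0 muln1 !mulnA.
apply: (@fifth_rep_of_root _ (N.to_nat t)); rewrite -e4; try lia.
have -> : (15 * N.to_nat m - N.to_nat (t * t * t * t) =
      N.to_nat (15 * m - t * t * t * t))%N by lia.
exact: classN_sound.
Qed.

Lemma small_ok5_sound m : small_ok5 m = true -> (N.to_nat m %% 16 != 0)%N ->
  fifth_rep (N.to_nat m).
Proof.
have gen : (let t := N.sqrt (N.sqrt (15 * m)) in
         if good_root5 m t then true else if good_root5 m (N.pred t) then true
         else if search5 1 m t then true else search5 5 m t) = true ->
   fifth_rep (N.to_nat m).
  move=> /=; case: ifP => [/good_root5_sound //|_]; case: ifP => [/good_root5_sound //|_].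
  case: ifP => [/search5_sound //|_]; exact: search5_sound.
rewrite /small_ok5; case: m gen => [//|[q|[q|[q|[q|q|]|]|]|]] gen h m16; try exact: gen.
exfalso; move: m16; lia.
Qed.

(** The m below 12^4 / 15. *)
Lemma check_fifths : all_range small_ok5 1 1382. Proof. by vm_compute. Qed.

Lemma fifth_rep_scale m : fifth_rep m -> fifth_rep (16 * m).
Proof.
move=> [x [y [z [w [[[a ->] [b ->] [c ->] [d ->]] hm [t ht]]]]]].
exists ((4 * a)%:R / 5), ((4 * b)%:R / 5), ((4 * c)%:R / 5), ((4 * d)%:R / 5); split.
- by split; [exists (4 * a)%N|exists (4 * b)%N|exists (4 * c)%N|exists (4 * d)%N].
- by rewrite !natrM hm; ring.
exists (2 * t); rewrite rmorphM exprMn -ht !natrM; ring.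
Qed.

(** Infinite descent from 16 m to m, which stops at 0. *)
Lemma mul16_ind (P : nat -> Prop) : P 0%N -> (forall m, P m -> P (16 * m)%N) ->
  (forall m, (m %% 16 != 0)%N -> P m) -> forall m, P m.
Proof.
move=> P0 PS Pn m; have [n] := ubnP m; elim: n m => // n IH m hm.
case: (eqVneq (m %% 16)%N 0%N) => [h|]; last exact: Pn.
case: (posnP m) => [->//|m0].
have -> : m = (16 * (m %/ 16))%N by lia.
by apply: PS; apply: IH; lia.
Qed.

Lemma fifth_rep_all m : fifth_rep m.
Proof.
move: m; apply: mul16_ind.
- exists 0, 0, 0, 0; split; [|by rewrite expr0n !addr0|by exists 0; rewrite !mulr0 !addr0].
  by split; exists 0%N; rewrite mul0r.
- exact: fifth_rep_scale.
move=> m m16; case: (leqP (12 ^ 4) (15 * m)) => h; first exact: fifth_rep_large.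
have e : m = N.to_nat (N.of_nat m) by rewrite Nat2N.id.
rewrite e; apply: small_ok5_sound; last by rewrite -e.
have m0 : (0 < m)%N by case: m m16 {h e}.
apply: (all_range_sound check_fifths); first by lia.
by move: h; rewrite -[(12 ^ 4)%N]/(12 * 12 * 12 * 12)%N; lia.
Qed.

(** * Conclusion *)

Lemma representable0 k (S : rat -> Prop) : S 0 -> representable k S 0.
Proof.
by move=> S0; exists 0, 0%N, 0, 0; split; rewrite // ?expr0n ?mulr0 ?addr0.
Qed.

Lemma rat_square_of_int r : int_square r -> rat_square r.
Proof. by case=> t ->; exists t%:~R. Qed.

Lemma representable_of_check integral (k p D : N) certs c :
  (N.to_nat p = 7 /\ N.to_nat k = 1 /\ c = 25 \/ N.to_nat p = 23 /\ N.to_nat k = 3 /\ c = 42)%N ->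
  D = (2 * k * k + 1)%num -> check_below integral k D p certs c = true ->
  forall m, representable (N.to_nat k) (square_kind integral) m.
Proof.
move=> hpk hD hchk; apply: mul16_ind.
- by apply: representable0; case: (integral); exists 0; rewrite ?rmorph0 expr0n.
- move=> m; apply: representable_scale => r; rewrite /square_kind.
  by case: (integral) => -[t ->]; exists (2 * t); rewrite ?rmorphM /=; ring.
move=> m m16; case: (leqP (c ^ 4) (N.to_nat p * m)) => h.
  have [x [y [z [w [x0 z0 w0 hm hs]]]]] := representable_large hpk m16 h.
  exists x, y, z, w; split => //; rewrite /square_kind.
  by case: (integral) => //; apply: rat_square_of_int.
have e : m = N.to_nat (N.of_nat m) by rewrite Nat2N.id.
rewrite e; apply: (check_below_sound _ hD hchk); rewrite -?e //.
by case: hpk => -[-> [-> _]]; [left|right].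
Qed.

Theorem theorem1p9 :
  [/\ (forall m : nat, exists (x y z : rat) (w : nat),
         [/\ 0 <= x, 0 <= y, 0 <= z,
             m%:R = x ^+ 2 + y ^+ 2 + z ^+ 2 + w%:R ^+ 2
           & rat_square (x + y + z + 2 * w%:R)]),
      (forall m : nat, exists x y z w : rat,
         [/\ [/\ nat_fifth x, nat_fifth y, nat_fifth z & nat_fifth w],
             m%:R = x ^+ 2 + y ^+ 2 + z ^+ 2 + w ^+ 2
           & int_square (x + y + 2 * z + 3 * w)])
    & (forall m : nat, exists (x : rat) (y : nat) (z w : rat),
         [/\ 0 <= x, 0 <= z, 0 <= w,
             m%:R = x ^+ 2 + y%:R ^+ 2 + z ^+ 2 + w ^+ 2
           & int_square (x + 2 * y%:R + 3 * z + 3 * w)])].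
Proof.
split=> m.
- have [|x [w [y [z [x0 y0 z0 hm hs]]]]] := representable_of_check _ erefl check_below_k1 m.
    by left.
  exists x, y, z, w; split => //; first by rewrite hm; ring.
  by move: hs; rewrite !mul1r; congr rat_square; ring.
- exact: fifth_rep_all.
have [|x [y [z [w [x0 z0 w0 hm hs]]]]] := representable_of_check _ erefl check_below_k3 m.
  by right.
by exists x, y, z, w.
Qed.
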